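(* Let $q\ge0$ be an integer and let $K\subset\mathbb{R}^d$ be a nonempty compact convex set with $0\in K$. Then the polynomial $\epsilon\mapsto\int_{K+\epsilon B}|s|^{2q}\,ds$ (for $\epsilon\ge0$) has nonnegative coefficients.
   Context: $B$ is the Euclidean unit ball of $\mathbb{R}^d$, $|\cdot|$ the Euclidean norm, $ds$ Lebesgue measure. The function $\epsilon\mapsto\int_{K+\epsilon B}|s|^{2q}ds$ is a polynomial in $\epsilon\ge0$. *)

(* Defs.v *)
From HB Require Import structures.
From mathcomp Require Import all_boot all_order all_algebra.
From mathcomp Require Import all_classical all_reals all_analysis.
Set Implicit Arguments. Unset Strict Implicit. Unset Printing Implicit Defensive.
Import Order.TTheory GRing.Theory Num.Theory.
Import numFieldNormedType.Exports.
Local Open Scope classical_set_scope.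
Local Open Scope ring_scope.

(* Euclidean norm |s| on R^d = 'rV[R]_d (MathComp's `|s| on matrices is the
   sup norm, hence this explicit definition). *)
Definition eucl_norm {R : realType} {d : nat} (s : 'rV[R]_d) : R :=
  Num.sqrt (\sum_(i < d) s 0 i ^+ 2).

Definition unit_ball (R : realType) (d : nat) : set 'rV[R]_d :=
  [set b | eucl_norm b <= 1].

Definition mink_ball {R : realType} {d : nat} (K : set 'rV[R]_d) (eps : R)
  : set 'rV[R]_d :=
  [set z | exists x b, K x /\ @unit_ball R d b /\ z = x + eps *: b].

Definition row_snoc {R : realType} {n : nat} (y : 'rV[R]_n) (x : R) : 'rV[R]_n.+1 :=
  \row_(i < n.+1) (if unlift ord_max i is Some j then y 0 j else x).

(* Lebesgue integral over R^n of a nonnegative (extended-real valued)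
   function, written as the iterated one-dimensional Lebesgue integral
   (for nonnegative measurable integrands this is the n-dimensional
   Lebesgue integral, by Tonelli). *)
Fixpoint lebesgue_int_Rn {R : realType} (n : nat)
  : ('rV[R]_n -> \bar R) -> \bar R :=
  match n return ('rV[R]_n -> \bar R) -> \bar R with
  | 0 => fun f => f 0
  | n'.+1 => fun f =>
      (\int[@lebesgue_measure R]_(x in [set: R])
          @lebesgue_int_Rn R n' (fun y => f (row_snoc y (x : R))))%E
  end.

Definition moment_integral {R : realType} {d : nat} (A : set 'rV[R]_d) (q : nat)
  : \bar R :=
  @lebesgue_int_Rn R d (fun s => (\1_A s * eucl_norm s ^+ (2 * q))%:E).

(* Main.v *)
Require Import Defs.
From HB Require Import structures.
From mathcomp Require Import all_boot all_order all_algebra.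
From mathcomp Require Import all_classical all_reals all_analysis.
From mathcomp Require Import measurable_realfun.
From mathcomp Require Import ring lra.
Set Implicit Arguments. Unset Strict Implicit. Unset Printing Implicit Defensive.
Import Order.TTheory GRing.Theory Num.Theory.
Import numFieldNormedType.Exports.
Local Open Scope classical_set_scope.
Local Open Scope ring_scope.

(** For a polytope [P] containing 0, split R^d into the regions on which the nearest
    point projection [p] hits the relative interior of a fixed face. On such a region
    [s |-> p s + l (s - p s)] is the restriction of an affine map with determinant
    [l ^ r], so the contribution of the region to the integral over [P + l B] is [l ^ r]
    times the integral of [(|p|^2 + 2 l p.n + l^2 |n|^2) ^ q], where [n = s - p s] and
    [|n| <= 1]. This is a polynomial in [l] with nonnegative coefficients, because
    [p.n >= 0] when 0 lies in [P]. A general [K] is squeezed between polytopes, and the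
    limit of these polynomials of bounded degree is again such a polynomial. *)

(** The moment is defined as an iterated integral, so it is first identified with an integral
    against a sigma-finite measure on ['rV[R]_n], where restriction to regions and dominated
    convergence are available. The only linear maps to substitute are [1 + (l - 1) F] with [F] an
    orthogonal projector; for [l > 0] they are definite, so elimination never meets a zero pivot and
    the change of variables goes by induction on the dimension. Faces are never handled as objects:
    a region is labelled by the set of constraints active at the projection, and what matters is
    that normals lie in the span of the active [a i] while differences of projections are orthogonal
    to it. The degree bound [n + 2 q] is the same for all polytopes, which lets coefficients pass to
    the limit. The map may be singular at [l = 0], so the moment formula is proved for [l > 0] and
    recovered at 0 by right continuity. *)

Fact rV_display : measure_display. Proof. exact: default_measure_display. Qed.

(** * Coordinate sigma-algebra on row vectors *)

Definition rV_coord_sets (R : realType) n : set (set 'rV[R]_n) :=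
  [set A : set 'rV[R]_n | exists i (B : set R), measurable B /\ A = [set s : 'rV[R]_n | B (s 0 i)]].

HB.instance Definition _ (R : realType) n := @isMeasurable.Build rV_display
  'rV[R]_n <<s @rV_coord_sets R n >> (@sigma_algebra0 _ setT _)
  (@sigma_algebraC _ _) (@sigma_algebra_bigcup _ setT _).

Section rV_measurable.
Variable R : realType.
Implicit Types n : nat.

Lemma measurable_rV_coord n (i : 'I_n) :
  measurable_fun setT (fun s : 'rV[R]_n => s 0 i).
Proof.
move=> _ B mB; rewrite setTI; apply: sub_gen_smallest.
by exists i, B.
Qed.

Lemma measurable_rVP d (T : measurableType d) n (f : T -> 'rV[R]_n) :
  (forall i, measurable_fun setT (fun x => f x 0 i)) -> measurable_fun setT f.
Proof.
move=> mf; apply: measurability => //.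
move=> _ [_ [i [B [mB ->]]] <-].
by have := mf i measurableT B mB.
Qed.

(** An open set is the union of the rational sup-norm boxes it contains, and there are countably
    many of these. *)
Lemma open_rV_measurable n (A : set 'rV[R]_n) : open A -> measurable A.
Proof.
move=> oA.
pose bx (z : 'rV[rat]_n * rat) : set 'rV[R]_n :=
  [set s | forall i, `|ratr (z.1 0 i) - s 0 i| < ratr z.2].
have mbx z : measurable (bx z).
  have -> : bx z = \bigcap_(i in [set: 'I_n])
     [set s | `|ratr (z.1 0 i) - s 0 i| < ratr z.2].
    by apply/seteqP; split=> s h => [i _|i]; apply: h.
  apply: fin_bigcap_measurable; first exact: finite_finset.
  move=> i _; apply: sub_gen_smallest; exists i.
  exists [set x | `|ratr (z.1 0 i) - x| < ratr z.2]; split => //.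
  apply: open_measurable.
  have -> : [set x : R | `|ratr (z.1 0 i) - x| < ratr z.2] =
     ball (ratr (z.1 0 i) : R) (ratr z.2 : R) by [].
  exact: ball_open.
have -> : A = \bigcup_(z in [set z | bx z `<=` A]) bx z.
  apply/seteqP; split=> [s As|s [z zA]]; last exact: zA.
  have /nbhs_ballP[e /= e0 eA] : nbhs s A by exact: open_nbhs_nbhs.
  have e20 : 0 < e / 2 by rewrite divr_gt0.
  have [r] := rat_in_itvoo e20; rewrite inE => /itvP hr; have r0 : 0 < ratr r :> R by rewrite hr.
  have re : ratr r < e / 2 by rewrite hr.
  have h i : exists x : rat, `|ratr x - s 0 i| < ratr r.
    have lt : s 0 i - ratr r < s 0 i + ratr r.
      by rewrite ltrD2l (lt_trans _ r0)// oppr_lt0.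
    have [x] := rat_in_itvoo lt; rewrite inE => /itvP hx.
    have h1 : s 0 i - ratr r < ratr x by rewrite hx.
    have h2 : ratr x < s 0 i + ratr r by rewrite hx.
    by exists x; rewrite ltr_norml; apply/andP; split; lra.
  exists (\row_i projT1 (cid (h i)), r) => /=; last first.
    by move=> i; rewrite mxE; case: cid.
  move=> t /= ht; apply: eA => /=; split=> // i j; rewrite (ord1 i).
  rewrite /ball /=; have := ht j; rewrite /= mxE; case: cid => x /= hx h1.
  rewrite -(subrK (ratr x) (s 0 j)) -addrA (le_lt_trans (ler_normD _ _))//.
  by rewrite distrC (splitr e) ltrD// (lt_trans _ re).
rewrite bigcup_mkcond; apply: countable_bigcupT_measurable => [|z].
  exact: countableP.
by case: ifP => _; [exact: mbx|exact: measurable0].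
Qed.

Lemma continuous_rV_measurable n (f : 'rV[R]_n -> R) :
  continuous f -> measurable_fun setT f.
Proof.
move=> /continuousP cf; apply: (measurability _ (RGenOpens.measurableE R)).
move=> _ [_ [a [b ->] <-]]; rewrite setTI.
by apply: open_rV_measurable; exact/cf/interval_open.
Qed.
End rV_measurable.

(** * Lebesgue measure on row vectors *)

Section sigma_finite_pack.
Context d (T : measurableType d) (R : realType).
Variables (mu : {measure set T -> \bar R}) (muS : sigma_finite setT mu).

(** An alias taking the proof of sigma-finiteness as argument, so that a measure proved sigma-finite
    along the way acquires the canonical structure. *)
Definition sigma_finite_pack of sigma_finite setT mu : set T -> \bar R := mu.

HB.instance Definition _ := Measure.copy (sigma_finite_pack muS) mu.
HB.instance Definition _ :=
  Measure_isSigmaFinite.Build _ _ _ (sigma_finite_pack muS) muS.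
End sigma_finite_pack.

Section lebesgue_rV.
Variable R : realType.
Implicit Types n : nat.

Lemma row_snoc_max n (y : 'rV[R]_n) x : row_snoc y x 0 ord_max = x.
Proof. by rewrite mxE unlift_none. Qed.

Lemma row_snoc_lift n (y : 'rV[R]_n) x j :
  row_snoc y x 0 (lift ord_max j) = y 0 j.
Proof. by rewrite mxE liftK. Qed.

Lemma measurable_row_snoc d (T : measurableType d) n (f : T -> 'rV[R]_n)
    (g : T -> R) : measurable_fun setT f -> measurable_fun setT g ->
  measurable_fun setT (fun t => row_snoc (f t) (g t)).
Proof.
move=> mf mg; apply: measurable_rVP => i.
case: (unliftP ord_max i) => [j ->|->].
  under eq_fun do rewrite row_snoc_lift.
  exact: measurableT_comp (measurable_rV_coord j) mf.
by under eq_fun do rewrite row_snoc_max.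
Qed.

Definition rV_box n (M : R) : set 'rV[R]_n := [set s | forall i, `|s 0 i| <= M].

Lemma rV_box_measurable n M : measurable (@rV_box n M).
Proof.
have -> : rV_box M = \bigcap_(i in [set: 'I_n]) [set s | `|s 0 i| <= M].
  by apply/seteqP; split=> s h => [i _|i]; apply: h.
apply: fin_bigcap_measurable; first exact: finite_finset.
move=> i _; rewrite [X in measurable X](_ : _ = (fun s : 'rV[R]_n => s 0 i) @^-1` `[-M, M]%classic).
  by rewrite -[X in measurable X]setTI; exact: measurable_rV_coord.
by apply/seteqP; split=> s /=; rewrite in_itv/= ler_norml.
Qed.

Lemma rV_box_sigma_finite n (mu : {measure set 'rV[R]_n -> \bar R}) :
  (forall M, mu (rV_box M) < +oo)%E -> sigma_finite setT mu.
Proof.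
move=> muy; exists (fun k => rV_box k%:R); last first.
  by move=> k; split => //; exact: rV_box_measurable.
apply/esym; rewrite -subTset => s _.
exists (Num.truncn (\sum_i `|s 0 i|)).+1 => //= i.
apply/ltW/(le_lt_trans _ (truncnS_gt _)).
by rewrite (bigD1 i)//= lerDl sumr_ge0.
Qed.

(** Finiteness on boxes is carried through the induction because it makes the next measure
    sigma-finite, as Tonelli's theorem demands. That measure is the image of a product measure under
    appending a last coordinate. *)
Lemma lebesgue_rV_ex n : exists2 mu : {sigma_finite_measure set 'rV[R]_n -> \bar R},
  (forall M, mu (rV_box M) < +oo)%E &
  forall f : 'rV[R]_n -> \bar R, measurable_fun setT f ->
    (forall s, 0 <= f s)%E -> lebesgue_int_Rn f = (\int[mu]_s f s)%E.
Proof.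
elim: n => [|n [mu muy IH]].
  exists \d_(0 : 'rV[R]_0) => [M|f mf f0].
    by apply: (@le_lt_trans _ _ 1%E); [exact: probability_le1 (rV_box_measurable _)|exact: ltry].
  by rewrite integral_dirac// diracT mul1e.
pose m2 := (@lebesgue_measure R \x mu)%E.
pose phi (z : measurableTypeR R * 'rV[R]_n) := row_snoc z.2 z.1.
have mphi : measurable_fun setT phi by exact: measurable_row_snoc.
have [nu nuE] : exists nu : {measure set 'rV[R]_n.+1 -> \bar R},
    pushforward m2 phi = nu.
  by unshelve eexists (pushforward m2 phi : {measure set 'rV[R]_n.+1 -> \bar R}).
have nuy M : (nu (rV_box M) < +oo)%E.
  have -> : nu (rV_box M) = m2 (`[- M, M]%classic `*` rV_box M).
    rewrite -nuE /pushforward; congr (m2 _); apply/seteqP; split=> -[x y].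
      move=> h; split; first by have := h ord_max; rewrite row_snoc_max/= in_itv/= ler_norml.
      by move=> i; have := h (lift ord_max i); rewrite row_snoc_lift.
    move=> [/= xM yM] i; case: (unliftP ord_max i) => [j ->|->].
      by rewrite row_snoc_lift; exact: yM.
    by move: xM; rewrite row_snoc_max in_itv/= ler_norml.
  rewrite /m2 product_measure1E//; last exact: rV_box_measurable.
  apply: lte_mul_pinfty => //.
  by rewrite [X in X \is a _](@lebesgue_measure_itv R `[-M, M]); case: ifP.
have nuS : sigma_finite setT nu by exact: rV_box_sigma_finite.
exists (sigma_finite_pack nuS) => // f mf f0.
have mf' : measurable_fun setT (f \o phi) by exact: measurableT_comp mf mphi.
rewrite -[RHS]/(\int[nu]_s f s)%E -nuE ge0_integral_pushforward//.
rewrite preimage_setT fubini_tonelli1//=.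
apply: eq_integral => x _; rewrite IH//.
by apply: (measurableT_comp mf); exact: measurable_row_snoc.
Qed.
End lebesgue_rV.

Section lebesgue_rV_integral.
Variable R : realType.
Implicit Types n : nat.

Definition lebesgue_rV n : {sigma_finite_measure set 'rV[R]_n -> \bar R} :=
  projT1 (cid2 (lebesgue_rV_ex R n)).

Lemma lebesgue_rV_box n M : (lebesgue_rV n (rV_box M) < +oo)%E.
Proof. by rewrite /lebesgue_rV; case: cid2 => mu /=. Qed.

Lemma lebesgue_int_RnE n (f : 'rV[R]_n -> \bar R) :
  measurable_fun setT f -> (forall s, 0 <= f s)%E ->
  lebesgue_int_Rn f = (\int[lebesgue_rV n]_s f s)%E.
Proof. by rewrite /lebesgue_rV; case: cid2 => mu /= _; apply. Qed.

Lemma lebesgue_rV_tonelli1 n (f : 'rV[R]_n.+1 -> \bar R) :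
  measurable_fun setT f -> (forall s, 0 <= f s)%E ->
  (\int[lebesgue_rV n.+1]_s f s =
   \int[@lebesgue_measure R]_x \int[lebesgue_rV n]_y f (row_snoc y (x : R)))%E.
Proof.
move=> mf f0; rewrite -lebesgue_int_RnE//=.
apply: eq_integral => x _; rewrite lebesgue_int_RnE//.
by apply: (measurableT_comp mf); exact: measurable_row_snoc.
Qed.

Lemma lebesgue_rV_tonelli2 n (f : 'rV[R]_n.+1 -> \bar R) :
  measurable_fun setT f -> (forall s, 0 <= f s)%E ->
  (\int[lebesgue_rV n.+1]_s f s =
   \int[lebesgue_rV n]_y \int[@lebesgue_measure R]_x f (row_snoc y (x : R)))%E.
Proof.
move=> mf f0; rewrite lebesgue_rV_tonelli1//.
pose g (z : measurableTypeR R * 'rV[R]_n) := f (row_snoc z.2 z.1).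
have mg : measurable_fun setT g.
  by apply: (measurableT_comp mf); exact: measurable_row_snoc.
by have := @fubini_tonelli _ _ _ _ _ (@lebesgue_measure R) (lebesgue_rV n) g mg (fun z => f0 _).
Qed.

(** The image measure scaled by [|a|] agrees with Lebesgue measure on half-open intervals, hence
    everywhere by uniqueness. *)
Lemma lebesgue_integral_affine (f : R -> \bar R) (a b : R) : a != 0 ->
  measurable_fun setT f -> (forall x, 0 <= f x)%E ->
  (\int[@lebesgue_measure R]_x f (a * x + b)%R * `|a|%:E =
   \int[@lebesgue_measure R]_x f x)%E.
Proof.
move=> a0 mf f0.
pose phi (x : measurableTypeR R) : measurableTypeR R := a * x + b.
have mphi : measurable_fun setT phi.
  by apply: continuous_measurable_fun => x; apply: cvgD; [exact: mulrl_continuous|exact: cvg_cst].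
have [m mE] : exists m : {measure set (measurableTypeR R) -> \bar R},
    pushforward (@lebesgue_measure R) phi = m.
  by unshelve eexists (pushforward (@lebesgue_measure R) phi :
    {measure set (measurableTypeR R) -> \bar R}).
have na0 : 0 <= `|a| by exact: normr_ge0.
have ocitvE (X : set R) : ocitv X ->
    lebesgue_measure X = mscale (NngNum na0) m X.
  move=> [[u v] /= _ <-]; have [uv|vu] := leP u v; last first.
    by rewrite set_itv_ge ?measure0//= bnd_simp -leNgt ltW.
  rewrite /mscale/= -mE /pushforward /phi.
  have itvE (lb rb : bool) (x y : R) : x <= y ->
      (`|a|%:E * lebesgue_measure [set` Interval (BSide lb x) (BSide rb y)] =
       (`|a| * (y - x))%:E)%E.
    move=> xy; rewrite [X in (_ * X)%E](@lebesgue_measure_itv R (Interval _ _))/= lte_fin.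
    by move: xy; rewrite le_eqVlt => /orP[/eqP->|->];
      rewrite ?ltxx ?subrr ?mulr0 ?mule0// -EFinD -EFinM.
  rewrite [LHS](@lebesgue_measure_itv R `]u, v])/= lte_fin.
  have -> : (if (u < v)%R then v%:E - u%:E else 0)%E = (v - u)%:E.
    by move: uv; rewrite le_eqVlt => /orP[/eqP->|->]; rewrite ?ltxx ?subrr// EFinB.
  have [a_gt0|a_lt0|/eqP] := ltgtP a 0; last by rewrite (negbTE a0).
  (* The first branch of [ltgtP a 0] is [a < 0], whatever the name of its hypothesis: the endpoints
     are exchanged and the preimage is closed on the left. *)
  - have -> : (fun x => a * x + b) @^-1` `]u, v] = `[(v - b) / a, (u - b) / a[%classic.
      apply/seteqP; split=> x /=; rewrite !in_itv/= => /andP[h1 h2].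
        by rewrite ler_ndivrMr// ltr_ndivlMr//; apply/andP; split; lra.
      move: h1 h2; rewrite ler_ndivrMr// ltr_ndivlMr// => h1 h2.
      by apply/andP; split; lra.
    rewrite itvE; last by rewrite ler_nM2r ?invr_lt0//; lra.
    by rewrite ltr0_norm//; congr EFin; field.
  - have -> : (fun x => a * x + b) @^-1` `]u, v] = `](u - b) / a, (v - b) / a]%classic.
      apply/seteqP; split=> x /=; rewrite !in_itv/= => /andP[h1 h2].
        by rewrite ler_pdivlMr// ltr_pdivrMr//; apply/andP; split; lra.
      move: h1 h2; rewrite ler_pdivlMr// ltr_pdivrMr// => h1 h2.
      by apply/andP; split; lra.
    rewrite itvE; last by rewrite ler_pM2r ?invr_gt0//; lra.
    by rewrite gtr0_norm//; congr EFin; field.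
rewrite [RHS](eq_measure_integral (mscale (NngNum na0) m)); last first.
  by move=> A mA _; exact: lebesgue_measure_unique.
rewrite ge0_integral_mscale//= -mE ge0_integral_pushforward// preimage_setT.
by rewrite muleC.
Qed.
End lebesgue_rV_integral.

(** * Affine change of variables *)

Section affine_change_of_variables.
Variable R : realType.
Implicit Types n : nat.

Lemma sum_ord_last (V : nmodType) n (F : 'I_n.+1 -> V) :
  \sum_i F i = \sum_j F (lift ord_max j) + F ord_max.
Proof.
rewrite big_ord_recr/=; congr (_ + _); apply: eq_bigr => j _; congr F.
by apply: val_inj; rewrite /= /bump leqNgt ltn_ord.
Qed.

Definition mx_snoc n (A : 'M[R]_n) (c : 'cV[R]_n) (r : 'rV[R]_n) (d : R) :
    'M[R]_n.+1 :=
  \matrix_(i, j) match unlift ord_max i, unlift ord_max j with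
  | Some i', Some j' => A i' j' | Some i', None => c i' 0
  | None, Some j' => r 0 j' | None, None => d end.

Lemma mx_snocE n (S : 'M[R]_n.+1) : S =
  mx_snoc (\matrix_(i, j) S (lift ord_max i) (lift ord_max j))
    (\col_i S (lift ord_max i) ord_max) (\row_j S ord_max (lift ord_max j))
    (S ord_max ord_max).
Proof.
apply/matrixP => i j; rewrite mxE.
by case: unliftP => [i'|] ->; case: unliftP => [j'|] ->; rewrite ?mxE.
Qed.

Lemma row_snoc_mulmx n A c r d (y : 'rV[R]_n) x :
  row_snoc y x *m mx_snoc A c r d =
  row_snoc (y *m A + x *: r) ((y *m c) 0 0 + x * d).
Proof.
apply/rowP => j; rewrite !mxE sum_ord_last row_snoc_max.
case: unliftP => [j'|] -> {j}; rewrite !mxE ?unlift_none ?liftK; congr (_ + _);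
  by apply: eq_bigr => i _; rewrite !mxE ?liftK ?unlift_none.
Qed.

Lemma mx_snoc_mul n A c r d A' c' r' d' : mx_snoc A c r d *m mx_snoc A' c' r' d' =
  mx_snoc (A *m A' + c *m r') (A *m c' + c *m d'%:M)
    (r *m A' + d *: r') ((r *m c') 0 0 + d * d') :> 'M[R]_n.+1.
Proof.
apply/matrixP => i j; rewrite !mxE sum_ord_last.
case: (unliftP ord_max i) => [i'|] ->; case: (unliftP ord_max j) => [j'|] ->;
  rewrite ?mxE ?unlift_none ?liftK ?big_ord1 ?mxE ?mulr1n; congr (_ + _).
all: try by apply: eq_bigr => k _; rewrite !mxE ?liftK ?unlift_none.
all: try by [].
Qed.

Lemma det_mx_snoc_ublock n A c d : \det (mx_snoc A c 0 d : 'M[R]_n.+1) = \det A * d.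
Proof.
rewrite (expand_det_row _ ord_max) sum_ord_last big1 ?add0r => [|j _]; last first.
  by rewrite !mxE unlift_none liftK mxE mul0r.
rewrite mxE unlift_none /cofactor -signr_odd oddD addbb expr0 mul1r mulrC.
by congr (\det _ * _); apply/matrixP => i j; rewrite !mxE !liftK.
Qed.

(** The matrix is a unit lower triangular block matrix with last row [r *m invmx A] times a block
    upper triangular one, whose last diagonal entry is the Schur complement. *)
Lemma det_mx_snoc n A c r d : A \in unitmx ->
  \det (mx_snoc A c r d : 'M[R]_n.+1) = \det A * (d - (r *m invmx A *m c) 0 0).
Proof.
move=> uA; rewrite -(det_mx_snoc_ublock A c) -[RHS]mul1r.
rewrite -[X in X * _](_ : \det (mx_snoc 1%:M 0 (r *m invmx A) 1) = 1).
  rewrite -det_mulmx mx_snoc_mul; congr (\det _); congr mx_snoc.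
  - by rewrite mul1mx mul0mx addr0.
  - by rewrite mul1mx mul0mx addr0.
  - by rewrite mulmxKV// scaler0 addr0.
  - by rewrite mul1r addrC subrK.
rewrite -det_tr (_ : _^T = mx_snoc 1%:M (r *m invmx A)^T 0 1) ?det_mx_snoc_ublock ?det1 ?mulr1//.
apply/matrixP => i j; rewrite !mxE.
by case: (unliftP ord_max i) => [i'|] _; case: (unliftP ord_max j) => [j'|] _;
  rewrite ?mxE// eq_sym.
Qed.

(** Non-vanishing of the quadratic form gives invertibility and passes to leading blocks, the two
    facts that elimination uses at each step. *)
Definition definite n (S : 'M[R]_n) :=
  forall v : 'rV[R]_n, v != 0 -> (v *m S *m v^T) 0 0 != 0.

Lemma definite_unitmx n (S : 'M[R]_n) : definite S -> S \in unitmx.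
Proof.
move=> dS; rewrite -row_free_unit -kermx_eq0; apply/negPn/negP.
move=> /rowV0Pn[v /sub_kermxP vS /dS]; by rewrite vS mul0mx mxE eqxx.
Qed.

Lemma definite_mx_snoc n A c r d : definite (mx_snoc A c r d : 'M[R]_n.+1) ->
  definite A.
Proof.
move=> dS v v0; have := dS (row_snoc v 0).
rewrite row_snoc_mulmx scale0r addr0 mul0r addr0.
have -> : forall x, (row_snoc (v *m A) x *m (row_snoc v 0)^T) 0 0 = (v *m A *m v^T) 0 0.
  move=> x; rewrite !mxE sum_ord_last [X in _ + _ * X]mxE row_snoc_max mulr0 addr0.
  by apply: eq_bigr => i _; rewrite row_snoc_lift; congr (_ * _); rewrite !mxE liftK.
apply; apply: contra_neq v0 => /rowP v0; apply/rowP => j.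
by have := v0 (lift ord_max j); rewrite row_snoc_lift !mxE.
Qed.

Lemma measurable_rVD d (T : measurableType d) n (f g : T -> 'rV[R]_n) :
  measurable_fun setT f -> measurable_fun setT g ->
  measurable_fun setT (fun t => f t + g t).
Proof.
move=> mf mg; apply: measurable_rVP => i; under eq_fun do rewrite mxE.
apply: measurable_funD.
  exact: (measurableT_comp (measurable_rV_coord i) mf).
exact: (measurableT_comp (measurable_rV_coord i) mg).
Qed.

Lemma measurable_mulmx d (T : measurableType d) n m (f : T -> 'rV[R]_n)
    (S : 'M[R]_(n, m)) : measurable_fun setT f ->
  measurable_fun setT (fun t => f t *m S).
Proof.
move=> mf; apply: measurable_rVP => i; under eq_fun do rewrite mxE.
apply: measurable_sum => j; apply: measurable_funM => //.
exact: (measurableT_comp (measurable_rV_coord j) mf).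
Qed.

Lemma integral_rV_inner_measurable n (f : 'rV[R]_n.+1 -> \bar R) :
  measurable_fun setT f -> (forall s, 0 <= f s)%E ->
  measurable_fun (setT : set (measurableTypeR R))
    (fun x => \int[lebesgue_rV R n]_y f (row_snoc y (x : R)))%E.
Proof.
move=> mf f0.
pose g (z : measurableTypeR R * 'rV[R]_n) := f (row_snoc z.2 z.1).
have mg : measurable_fun setT g.
  by apply: (measurableT_comp mf); exact: measurable_row_snoc.
exact: (@measurable_fun_fubini_tonelli_F _ _ _ _ _ (lebesgue_rV R n) g mg (fun z => f0 _)).
Qed.

Lemma integral_last_inner_measurable n (f : 'rV[R]_n.+1 -> \bar R) :
  measurable_fun setT f -> (forall s, 0 <= f s)%E ->
  measurable_fun setT
    (fun y => \int[@lebesgue_measure R]_x f (row_snoc y (x : R)))%E.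
Proof.
move=> mf f0.
pose g (z : measurableTypeR R * 'rV[R]_n) := f (row_snoc z.2 z.1).
have mg : measurable_fun setT g.
  by apply: (measurableT_comp mf); exact: measurable_row_snoc.
exact: (@measurable_fun_fubini_tonelli_G _ _ _ _ _ (@lebesgue_measure R) g mg (fun z => f0 _)).
Qed.

(* Solving for the first [n] coordinates leaves a one-dimensional substitution
   in the last coordinate whose slope is the Schur complement. *)
Lemma integral_rV_affine n (S : 'M[R]_n) (b : 'rV[R]_n) (f : 'rV[R]_n -> \bar R) :
  definite S -> measurable_fun setT f -> (forall s, 0 <= f s)%E ->
  (\int[lebesgue_rV R n]_s f (s *m S + b)%R * `|\det S|%:E =
   \int[lebesgue_rV R n]_s f s)%E.
Proof.
elim: n S b f => [|n IH] S b f dS mf f0.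
  rewrite det_mx00 normr1 mule1; apply: eq_integral => s _; congr f.
  by apply/rowP => -[].
move: dS; rewrite (mx_snocE S).
move: (\matrix_(i, j) _) (\col__ _) (\row__ _) (S _ _) => A c r d dS.
have dA := definite_mx_snoc dS; have uA := definite_unitmx dA.
have uS := definite_unitmx dS.
rewrite det_mx_snoc// normrM; set d' := d - _.
have d'0 : d' != 0.
  by move: uS; rewrite unitmxE det_mx_snoc// unitrM => /andP[_]; rewrite unitfE.
(* With [z = y A + x r + b'], where [b'] is [b] without its last entry, the last coordinate
   [y c + x d + b_last] becomes [d' x + e z]. *)
pose e (z : 'rV[R]_n) := ((z - \row_j b 0 (lift ord_max j)) *m invmx A *m c) 0 0 + b 0 ord_max.
have me : measurable_fun setT e.
  apply: measurable_funD => //.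
  apply: (measurableT_comp (measurable_rV_coord 0)).
  by do 2 apply: measurable_mulmx; apply: measurable_rVD.
pose h (s : 'rV[R]_n.+1) :=
  f (row_snoc (\row_j s 0 (lift ord_max j)) (d' * s 0 ord_max + e (\row_j s 0 (lift ord_max j)))).
have hE y x : h (row_snoc y x) = f (row_snoc y (d' * x + e y)).
  have E : \row_j row_snoc y x 0 (lift ord_max j) = y.
    by apply/rowP => j; rewrite mxE row_snoc_lift.
  by rewrite /h row_snoc_max !E.
have minit : measurable_fun setT (fun s : 'rV[R]_n.+1 => \row_j s 0 (lift ord_max j)).
  by apply: measurable_rVP => i; under eq_fun do rewrite mxE; exact: measurable_rV_coord.
have mh : measurable_fun setT h.
  apply: (measurableT_comp mf); apply: measurable_row_snoc => //.
  apply: measurable_funD; last exact: (measurableT_comp me minit).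
  by apply: measurable_funM => //; exact: measurable_rV_coord.
have h0 s : (0 <= h s)%E by exact: f0.
rewrite EFinM muleA lebesgue_rV_tonelli1//; last first.
  apply: (measurableT_comp mf); apply: measurable_rVD => //.
  exact: measurable_mulmx.
have mi : measurable_fun (setT : set (measurableTypeR R))
    (fun x => \int[lebesgue_rV R n]_y
       f (row_snoc y (x : R) *m mx_snoc A c r d + b)%R)%E.
  apply: (@integral_rV_inner_measurable _ (fun s => f (s *m mx_snoc A c r d + b))) => //.
  apply: (measurableT_comp mf); apply: measurable_rVD => //.
  exact: measurable_mulmx.
rewrite -ge0_integralZr//; last by move=> x _; exact: integral_ge0.
transitivity (\int[@lebesgue_measure R]_x
    \int[lebesgue_rV R n]_y h (row_snoc y (x : R)) * `|d'|%:E)%E.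
  congr (_ * _)%E; apply: eq_integral => x _.
  pose g z := h (row_snoc z x).
  have mg : measurable_fun setT g.
    by apply: (measurableT_comp mh); exact: measurable_row_snoc.
  rewrite -(IH A (x *: r + \row_j b 0 (lift ord_max j)) g dA mg (fun z => h0 _)).
  congr (_ * _)%E.
  apply: eq_integral => y _; rewrite /g hE; congr f.
  rewrite row_snoc_mulmx /e addrA addrK mulmxDl mulmxK// mulmxDl.
  apply/rowP => i; rewrite mxE; case: (unliftP ord_max i) => [j|] ->.
    by rewrite !row_snoc_lift !mxE.
  rewrite !row_snoc_max /d' -!scalemxAl [X in _ = _ + (X + _)]mxE.
  by rewrite [X in _ = _ + (_ + X + _)]mxE; ring.
(* Exchanging the order makes [x] the inner variable, ready for the substitution of slope [d']. *)
rewrite -lebesgue_rV_tonelli1// lebesgue_rV_tonelli2//.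
rewrite -ge0_integralZr//; last first.
- by move=> y _; exact: integral_ge0.
- exact: integral_last_inner_measurable.
rewrite lebesgue_rV_tonelli2//; apply: eq_integral => y _.
under eq_integral do rewrite hE.
rewrite (@lebesgue_integral_affine R (fun x => f (row_snoc y x)))//.
by apply: (measurableT_comp mf); exact: measurable_row_snoc.
Qed.
End affine_change_of_variables.

(** * Nearest point projection onto a convex set *)

Section projection.
Variables (R : realType) (n : nat).
Implicit Types (u v w s t x y p q : 'rV[R]_n) (K : set 'rV[R]_n).

Definition dot u v : R := \sum_i u 0 i * v 0 i.

Lemma dotC u v : dot u v = dot v u.
Proof. by apply: eq_bigr => i _; rewrite mulrC. Qed.

Lemma dotDl u v w : dot (u + v) w = dot u w + dot v w.
Proof. by rewrite -big_split; apply: eq_bigr => i _; rewrite mxE mulrDl. Qed.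

Lemma dotZl a u v : dot (a *: u) v = a * dot u v.
Proof. by rewrite mulr_sumr; apply: eq_bigr => i _; rewrite mxE mulrA. Qed.

Lemma dotNl u v : dot (- u) v = - dot u v.
Proof. by rewrite -scaleN1r dotZl mulN1r. Qed.

Lemma dotDr u v w : dot u (v + w) = dot u v + dot u w.
Proof. by rewrite !(dotC u) dotDl. Qed.

Lemma dotZr a u v : dot u (a *: v) = a * dot u v.
Proof. by rewrite !(dotC u) dotZl. Qed.

Lemma dotNr u v : dot u (- v) = - dot u v.
Proof. by rewrite !(dotC u) dotNl. Qed.

Definition dotE := (dotDl, dotDr, dotZl, dotZr, dotNl, dotNr).

Lemma dot_ge0 u : 0 <= dot u u.
Proof. by apply: sumr_ge0 => i _; rewrite -expr2 sqr_ge0. Qed.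

Lemma dot_eq0 u : (dot u u == 0) = (u == 0).
Proof.
apply/eqP/eqP => [|->]; last by rewrite /dot big1// => i _; rewrite mxE mul0r.
move=> /eqP; rewrite psumr_eq0 => [/allP u0|i _]; last by rewrite -expr2 sqr_ge0.
apply/rowP => i; have := u0 i (mem_index_enum i).
by rewrite mxE -expr2 sqrf_eq0 => /eqP.
Qed.

Lemma dot_mulmx u v : (u *m v^T) 0 0 = dot u v.
Proof. by rewrite mxE; apply: eq_bigr => i _; rewrite mxE. Qed.

Lemma eucl_norm_sqr u : eucl_norm u ^+ 2 = dot u u.
Proof.
rewrite sqr_sqrtr; first by apply: eq_bigr => i _; rewrite expr2.
by apply: sumr_ge0 => i _; exact: sqr_ge0.
Qed.

Lemma sqr_coord_le_dot u i : u 0 i ^+ 2 <= dot u u.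
Proof.
rewrite /dot (bigD1 i)//= expr2 lerDl; apply: sumr_ge0 => j _.
by rewrite -expr2 sqr_ge0.
Qed.

Lemma continuous_dot (f g : 'rV[R]_n -> 'rV[R]_n) :
  (forall i, continuous (fun s => f s 0 i)) ->
  (forall i, continuous (fun s => g s 0 i)) ->
  continuous (fun s => dot (f s) (g s)).
Proof.
move=> cf cg; rewrite /dot; elim: (index_enum _) => [|i r IH].
  by under eq_fun do rewrite big_nil; exact: cst_continuous.
under eq_fun do rewrite big_cons.
move=> s; apply: (@continuousD R R^o _ (fun s => f s 0 i * g s 0 i)); last exact: IH.
exact: (continuousM (cf i s) (cg i s)).
Qed.

Lemma continuous_dist_sqr s : continuous (fun y => dot (s - y) (s - y)).
Proof.
suff h i : continuous (fun y : 'rV[R]_n => (s - y) 0 i) by exact: continuous_dot.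
rewrite (_ : (fun y => _) = (fun y : 'rV[R]_n => s 0 i - y 0 i)); last first.
  by apply/funext => y; rewrite !mxE.
move=> y; apply: (@continuousB R R^o _ (cst (s 0 i)) (fun y => y 0 i)).
  exact: cst_continuous.
exact: coord_continuous.
Qed.

Lemma measurable_dot d (T : measurableType d) (f g : T -> 'rV[R]_n) :
  measurable_fun setT f -> measurable_fun setT g ->
  measurable_fun setT (fun a => dot (f a) (g a)).
Proof.
move=> mf mg; apply: measurable_sum => i; apply: measurable_funM.
  exact: (measurableT_comp (measurable_rV_coord i) mf).
exact: (measurableT_comp (measurable_rV_coord i) mg).
Qed.

(** Characterising the nearest point by its variational inequality makes uniqueness, contraction,
    stability along normal rays and the sign at [y = 0] purely algebraic. *)
Definition is_proj K s p := K p /\ forall y, K y -> dot (y - p) (s - p) <= 0.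

Definition convex K := forall x y (t : R), 0 <= t <= 1 -> K x -> K y ->
  K (x + t *: (y - x)).

Lemma convex_setE K : convex_set (K : set (convex_lmodType 'rV[R]_n)) -> convex K.
Proof.
move=> cK x y t /andP[t0 t1] Kx Ky.
have := cK y x (Itv01 t0 t1); rewrite !inE => /(_ Ky Kx).
rewrite /conv/=; congr K.
rewrite scalerBl scale1r scalerBr addrCA; congr (_ + _); rewrite addrC.
Qed.

Lemma is_proj_ex K s : K !=set0 -> compact K -> convex K -> exists p, is_proj K s p.
Proof.
move=> K0 cK vK.
pose f y := dot (s - y) (s - y).
have cf : continuous f by exact: continuous_dist_sqr.
have [p Kp minp] := EVT_min_rV K0 cK (continuous_subspaceT cf).
rewrite inE in Kp; exists p; split=> // y Ky; rewrite leNgt; apply/negP => D0.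
set D := dot _ _ in D0; pose N := dot (y - p) (y - p).
have N0 : 0 <= N := dot_ge0 _.
(* Moving from [p] by [t (y - p)] changes the squared distance by [t (t N - 2 D)]; this is negative
   because [t N <= D]. *)
pose t := D / (D + N).
have t0 : 0 < t by rewrite divr_gt0// ltr_wpDr.
have t1 : t <= 1 by rewrite ler_pdivrMr ?ltr_wpDr// mul1r lerDl.
have := minp (p + t *: (y - p)); rewrite inE => /(_ (vK _ _ _ _ Kp Ky)).
rewrite ltW// t1 => /(_ isT).
have -> : f (p + t *: (y - p)) = f p - 2 * t * D + t ^+ 2 * N.
  rewrite /f /D /N opprD addrA !(dotDl (s - p)) !(dotDr _ (s - p)) !dotNl !dotNr.
  by rewrite !dotZl !dotZr (dotC (s - p) (y - p)); ring.
rewrite -addrA lerDl addrC subr_ge0 -subr_ge0.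
have -> : t ^+ 2 * N - 2 * t * D = t * (t * N - 2 * D) by ring.
rewrite pmulr_rge0// subr_ge0 /t mulrAC ler_pdivlMr ?ltr_wpDr//.
by nra.
Qed.

(** Adding the two variational inequalities gives [|p - q|^2 <= (p - q).(s - t)]; non-negativity of
    [|(p - q) - (s - t)|^2] concludes. *)
Lemma is_proj_contract K s t p q : is_proj K s p -> is_proj K t q ->
  dot (p - q) (p - q) <= dot (s - t) (s - t).
Proof.
move=> [Kp hp] [Kq hq]; have h1 := hp _ Kq; have h2 := hq _ Kp.
have := dot_ge0 ((p - q) - (s - t)).
move: h1 h2; rewrite !dotE (dotC q p) (dotC s p) (dotC s q) (dotC t p) (dotC t q) (dotC s t).
lra.
Qed.

Lemma is_proj_uniq K s p q : is_proj K s p -> is_proj K s q -> p = q.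
Proof.
move=> hp hq; have := is_proj_contract hp hq.
have /eqP -> : dot (s - s) (s - s) == 0 by rewrite dot_eq0 subrr.
move=> h; apply/eqP; rewrite -subr_eq0 -dot_eq0.
by rewrite eq_le h dot_ge0.
Qed.

Lemma is_proj_min K s p y : is_proj K s p -> K y ->
  dot (s - p) (s - p) <= dot (s - y) (s - y).
Proof.
move=> [_ hp] Ky; have := hp _ Ky; have := dot_ge0 (p - y).
rewrite !dotE (dotC y s) (dotC p s) (dotC y p); lra.
Qed.

(** This is why the dilation by [l] along normals keeps each point in its region. *)
Lemma is_proj_ray K s p (l : R) : 0 <= l -> is_proj K s p ->
  is_proj K (p + l *: (s - p)) p.
Proof.
move=> l0 [Kp hp]; split=> // y /hp h.
by rewrite [p + _]addrC addrK dotZr mulr_ge0_le0.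
Qed.

Lemma continuous_proj K (P : 'rV[R]_n -> 'rV[R]_n) : (forall s, is_proj K s (P s)) ->
  forall i, continuous (fun s => P s 0 i).
Proof.
move=> hP i s; apply/(@cvgrPdist_lt _ _ _ (nbhs s) (nbhs_filter s)) => e e0.
have /(@cvgrPdist_lt _ _ _ (nbhs s) (nbhs_filter s))/(_ _ (exprn_gt0 2 e0)) :=
  @continuous_dist_sqr s s.
have /eqP -> : dot (s - s) (s - s) == 0 by rewrite dot_eq0 subrr.
apply: filterS => t; rewrite sub0r normrN ger0_norm ?dot_ge0// => h.
rewrite -(@ltr_pXn2r _ 2) ?nnegrE ?normr_ge0 ?ltW//.
rewrite (le_lt_trans _ h)// real_normK ?num_real//.
apply: (le_trans _ (is_proj_contract (hP s) (hP t))).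
by have := sqr_coord_le_dot (P s - P t) i; rewrite !mxE.
Qed.

Lemma measurable_proj K (P : 'rV[R]_n -> 'rV[R]_n) : (forall s, is_proj K s (P s)) ->
  measurable_fun setT P.
Proof.
move=> hP; apply: measurable_rVP => i; apply: continuous_rV_measurable.
exact: continuous_proj hP i.
Qed.

Lemma mink_ballE K s p (l : R) : 0 <= l -> is_proj K s p ->
  mink_ball K l s <-> dot (s - p) (s - p) <= l ^+ 2.
Proof.
move=> l0 hp; split=> [[x [b [Kx [b1 sE]]]]|h].
  apply: (le_trans (is_proj_min hp Kx)).
  rewrite sE [x + _]addrC addrK dotZl dotZr mulrA -expr2 ler_piMr ?sqr_ge0//.
  by rewrite -eucl_norm_sqr expr_le1// sqrtr_ge0.
move: l0; rewrite le_eqVlt => /orP[/eqP l0|l0].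
  exists p, 0; split; first by case: hp.
  split; first by rewrite /unit_ball/= /eucl_norm big1 ?sqrtr0 ?ler01// => i _; rewrite mxE expr0n.
  rewrite scaler0 addr0; apply/eqP; rewrite -subr_eq0 -dot_eq0 eq_le dot_ge0.
  by rewrite (le_trans h)// -l0 expr0n.
exists p, (l^-1 *: (s - p)); split; first by case: hp.
split; last by rewrite scalerA divff ?gt_eqF// scale1r addrC subrK.
rewrite /unit_ball/= -(@ler_pXn2r _ 2) ?nnegrE ?sqrtr_ge0 ?ler01//.
rewrite eucl_norm_sqr dotZl dotZr mulrA -expr2 expr1n exprVn mulrC.
by rewrite ler_pdivrMr ?exprn_gt0// mul1r.
Qed.
End projection.

(** * Orthogonal projectors and determinants of partial dilations *)

Section scaling_matrix.
Variable R : realType.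

(** [F] is [B^T (B B^T)^-1 B] for a row basis [B] of [A]; the Gram matrix [G] is invertible since
    [v G = 0] forces [|v B|^2 = 0]. *)
Lemma orthogonal_projector_ex m n (A : 'M[R]_(m, n)) : exists F : 'M[R]_n,
  [/\ F^T = F, F *m F = F, (forall v : 'rV_n, (v <= A)%MS -> v *m F = v) &
      forall v : 'rV_n, v *m A^T = 0 -> v *m F = 0].
Proof.
have := eq_row_base A; have := row_base_free A.
move: (row_base A) => B fB eB; pose G := B *m B^T.
have uG : G \in unitmx.
  rewrite -row_free_unit -kermx_eq0; apply/negPn/negP => /rowV0Pn[v /sub_kermxP vG].
  apply/negP; rewrite negbK; have : v *m B == 0.
    by rewrite -dot_eq0 -dot_mulmx trmx_mul mulmxA -(mulmxA v) -/G vG mul0mx mxE eqxx.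
  by rewrite -(mul0mx _ B) (inj_eq (row_free_inj fB)).
have GT : G^T = G by rewrite /G trmx_mul trmxK.
exists (B^T *m invmx G *m B); split.
- by rewrite !trmx_mul trmxK trmx_inv GT mulmxA.
- by rewrite !mulmxA -(mulmxA _ B) -/G mulmxK.
- move=> v; rewrite -eB => /submxP[x ->].
  by rewrite !mulmxA -(mulmxA x) -/G mulmxK.
- move=> v vA; have [C BE] : exists C, B = C *m A.
    by apply/submxP; rewrite eB.
  by rewrite BE trmx_mul !mulmxA vA !mul0mx.
Qed.

Definition scaling_mx n (F : 'M[R]_n) (l : R) : 'M[R]_n := 1%:M + (l - 1) *: F.

Lemma mul_scaling_mx n (F : 'M[R]_n) v l :
  v *m scaling_mx F l = v - v *m F + l *: (v *m F) :> 'rV_n.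
Proof.
by rewrite /scaling_mx mulmxDr mulmx1 -scalemxAr scalerBl scale1r [_ *: _ - _]addrC addrA.
Qed.

Lemma scaling_mxM n (F : 'M[R]_n) l k : F *m F = F ->
  scaling_mx F l *m scaling_mx F k = scaling_mx F (l * k).
Proof.
move=> FF; rewrite /scaling_mx mulmxDl mul1mx mulmxDr mulmx1.
rewrite -scalemxAl -scalemxAr FF scalerA -addrA; congr (_ + _).
by rewrite -!scalerDl; congr (_ *: _); ring.
Qed.

Lemma scaling_mx1 n (F : 'M[R]_n) : scaling_mx F 1 = 1%:M.
Proof. by rewrite /scaling_mx subrr scale0r addr0. Qed.

Lemma definite_scaling_mx n (F : 'M[R]_n) l : F^T = F -> F *m F = F -> 0 < l ->
  definite (scaling_mx F l).
Proof.
move=> FT FF l0 v; apply: contra_neq.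
rewrite dot_mulmx mul_scaling_mx => /eqP.
have vF : dot v (v *m F) = dot (v *m F) (v *m F).
  by rewrite -!dot_mulmx trmx_mul FT !mulmxA -(mulmxA v F F) FF.
have -> : dot (v - v *m F + l *: (v *m F)) v =
    dot (v - v *m F) (v - v *m F) + l * dot (v *m F) (v *m F).
  by rewrite !dotE [dot (v *m F) v]dotC vF; ring.
rewrite paddr_eq0 ?dot_ge0 ?mulr_ge0 ?dot_ge0 ?ltW//.
rewrite mulf_eq0 !dot_eq0 (gt_eqF l0)/= => /andP[/eqP h /eqP vF0].
by move: h; rewrite vF0 subr0.
Qed.

Lemma poly_eq_on_nat (p q : {poly R}) : (forall k : nat, p.[k%:R] = q.[k%:R]) -> p = q.
Proof.
move=> pq; apply/eqP; rewrite -subr_eq0; apply/eqP.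
apply: (@roots_geq_poly_eq0 _ _ [seq k%:R | k <- iota 0 (size (p - q))]).
- by apply/allP => _ /mapP[k _ ->]; rewrite rootE hornerD hornerN pq subrr.
- by rewrite map_inj_uniq ?iota_uniq//; exact: mulrIn (oner_neq0 _).
- by rewrite size_map size_iota.
Qed.

(** As polynomials in [k], the two sides of [p(l) p(k) = p(l k)] have coefficients [p(l) p_i] and
    [p_i l^i]; the leading one can be cancelled. *)
Lemma multiplicative_poly (p : {poly R}) :
  p.[1] = 1 -> (forall l k, p.[l] * p.[k] = p.[l * k]) ->
  forall l, p.[l] = l ^+ (size p).-1.
Proof.
move=> p1 pM l.
have p0 : p != 0 by apply: contra_eq_neq p1 => ->; rewrite horner0 eq_sym oner_eq0.
have E : p.[l] *: p = \poly_(i < size p) (p`_i * l ^+ i).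
  apply: poly_eq_on_nat => k; rewrite hornerZ pM horner_poly horner_coef.
  by apply: eq_bigr => i _; rewrite exprMn mulrA.
have := congr1 (fun q : {poly R} => q`_(size p).-1) E.
rewrite coefZ coef_poly prednK ?size_poly_gt0// leqnn mulrC.
by move/mulfI; apply; rewrite -lead_coefE lead_coef_eq0.
Qed.

(** No diagonalisation: the determinant is a polynomial in [l], multiplicative by [scaling_mxM] and
    1 at [l = 1], hence a power of [l]. *)
Lemma det_scaling_mx n (F : 'M[R]_n) : F *m F = F ->
  exists2 r, (r <= n)%N & forall l, \det (scaling_mx F l) = l ^+ r.
Proof.
move=> FF.
pose M : 'M[{poly R}]_n := \matrix_(i, j) ((1%:M i j)%:P + ('X - 1) * (F i j)%:P).
have detM l : (\det M).[l] = \det (scaling_mx F l).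
  rewrite -horner_evalE -det_map_mx; congr (\det _); apply/matrixP => i j.
  by rewrite !mxE [LHS]horner_evalE !hornerE.
exists (size (\det M)).-1 => [|l]; last first.
  rewrite -detM; apply: multiplicative_poly => [|k k'].
    by rewrite detM scaling_mx1 det1.
  by rewrite !detM -det_mulmx scaling_mxM.
suff : (size (\det M) <= n.+1)%N by case: (size _).
have hM i j : (size (M i j) <= 2)%N.
  rewrite mxE (leq_trans (size_polyD _ _))// geq_max.
  rewrite (leq_trans (size_polyC_leq1 _))//= (leq_trans (size_polyMleq _ _))//.
  rewrite -polyC1 size_XsubC addSn/= addSn ltnS.
  exact: size_polyC_leq1.
rewrite (leq_trans (size_sum _ _ _))//; apply/bigmax_leqP => s _.
rewrite -signr_odd; case: odd; rewrite ?expr1 ?expr0 ?mulN1r ?mul1r ?size_polyN.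
(* A product of [n] entries of size at most 2 has size at most [2 n + 1 - n]. *)
all: rewrite (leq_trans (size_prod_leq _ _))// leq_subLR.
all: rewrite card_ord addnS ltnS addnn -muln2 -[X in (_ <= X * 2)%N]card_ord -sum_nat_const.
all: by apply: leq_sum => i _; exact: hM.
Qed.

End scaling_matrix.

(** * Coefficientwise integration of polynomials *)

Section integral_of_polynomial.
Context d (T : measurableType d) (R : realType).

Definition coef_measurable (f : T -> {poly R}) :=
  forall k, measurable_fun setT (fun x => (f x)`_k).

Definition coef_nonneg (p : {poly R}) := forall k, 0 <= p`_k.

Lemma coef_measurableM f g : coef_measurable f -> coef_measurable g ->
  coef_measurable (fun x => f x * g x).
Proof.
move=> mf mg k; under eq_fun do rewrite coefM.
by apply: measurable_sum => j; apply: measurable_funM.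
Qed.

Lemma coef_nonnegM p q : coef_nonneg p -> coef_nonneg q -> coef_nonneg (p * q).
Proof. by move=> p0 q0 k; rewrite coefM sumr_ge0// => j _; rewrite mulr_ge0. Qed.

Lemma coef_measurableX f q : coef_measurable f ->
  coef_measurable (fun x => f x ^+ q).
Proof.
move=> mf; elim: q => [|q IH] k.
  by under eq_fun do rewrite expr0; exact: measurable_cst.
by under eq_fun do rewrite exprS; exact: coef_measurableM.
Qed.

Lemma coef_nonnegX p q : coef_nonneg p -> coef_nonneg (p ^+ q).
Proof.
move=> p0; elim: q => [|q IH]; last by rewrite exprS; exact: coef_nonnegM.
by move=> k; rewrite expr0 coef1 ler0n.
Qed.

(** Since all coefficients are non-negative, finiteness of the single value at [l = 1] bounds every
    coefficient integral. *)
Lemma integral_poly (mu : {measure set T -> \bar R}) (A : set T)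
    (f : T -> {poly R}) N : measurable A -> coef_measurable f ->
  (forall x, coef_nonneg (f x)) -> (forall x, (size (f x) <= N)%N) ->
  (\int[mu]_(x in A) ((f x).[1])%:E < +oo)%E ->
  exists p : {poly R}, [/\ coef_nonneg p, (size p <= N)%N &
    forall l, 0 <= l -> (\int[mu]_(x in A) ((f x).[l])%:E = (p.[l])%:E)%E].
Proof.
move=> mA mf f0 sf f1y.
have mfl k (l : R) : measurable_fun A (fun x => ((f x)`_k * l)%:E).
  apply: measurable_funTS; apply/measurable_EFinP; exact: measurable_funM.
pose c k := (\int[mu]_(x in A) ((f x)`_k)%:E)%E.
have c0 k : (0 <= c k)%E by apply: integral_ge0 => x _; rewrite lee_fin f0.
have intE l : 0 <= l -> (\int[mu]_(x in A) ((f x).[l])%:E =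
    \sum_(k < N) c k * (l ^+ k)%:E)%E.
  move=> l0; under eq_integral.
    move=> x _; rewrite (horner_coef_wide _ (sf x)) -sumEFin; over.
  rewrite ge0_integral_sum//; last first.
    by move=> k x _; rewrite lee_fin mulr_ge0 ?f0 ?exprn_ge0.
  apply: eq_bigr => k _; under eq_integral do rewrite EFinM.
  rewrite ge0_integralZr//.
  - by have := mfl k 1; under eq_fun do rewrite mulr1.
  - by move=> x _; rewrite lee_fin f0.
  - by rewrite lee_fin exprn_ge0.
have cfin k : (k < N)%N -> c k \is a fin_num.
  move=> kN; rewrite ge0_fin_numE//; apply: le_lt_trans f1y.
  rewrite intE ?ler01// (bigD1 (Ordinal kN))//= expr1n mule1 leeDl//.
  by apply: sume_ge0 => j _; rewrite expr1n mule1.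
exists (\poly_(k < N) fine (c k)); split; [|exact: size_poly|].
  by move=> k; rewrite coef_poly; case: ifP => // _; rewrite fine_ge0.
move=> l l0; rewrite intE// horner_poly -sumEFin; apply: eq_bigr => k _.
by rewrite EFinM fineK// cfin.
Qed.
End integral_of_polynomial.

(** * Contribution of one region *)

Section region.
Variables (R : realType) (n q : nat) (K : set 'rV[R]_n) (P : 'rV[R]_n -> 'rV[R]_n).
Hypothesis hP : forall s, is_proj K s (P s).
Hypothesis K0 : K 0.
Variable M : R.
Hypothesis hM : forall p, K p -> forall i, `|p 0 i| <= M.

Let nrm (s : 'rV[R]_n) := s - P s.

Let P_ray s l : 0 <= l -> P (P s + l *: nrm s) = P s.
Proof. by move=> l0; apply: (is_proj_uniq (hP _)); exact: is_proj_ray. Qed.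

Let nrm_ray s l : 0 <= l -> nrm (P s + l *: nrm s) = l *: nrm s.
Proof. by move=> l0; rewrite {1}/nrm P_ray// addrC addKr. Qed.

Let mP : measurable_fun setT P. Proof. exact: measurable_proj hP. Qed.

Let mnrm : measurable_fun setT nrm.
Proof.
apply: measurable_rVP => i; under eq_fun do rewrite !mxE.
apply: measurable_funB; first exact: measurable_rV_coord.
exact: (measurableT_comp (measurable_rV_coord i) mP).
Qed.

Lemma measurable_dist_le l : measurable [set s | dot (nrm s) (nrm s) <= l].
Proof.
rewrite -[X in measurable X]setTI.
by apply: measurable_fun_le => //; exact: measurable_dot.
Qed.

(* On [G] the map [s |-> P s + l *: (s - P s)] is the affine map of linear part
   [scaling_mx F l] fixing [c]; it maps the points of [G] at distance at most 1
   from [K] onto those at distance at most [l], and it has a constant Jacobian. *)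
Lemma integral_region (G : set 'rV[R]_n) (F : 'M[R]_n) (c : 'rV[R]_n) :
  measurable G -> F^T = F -> F *m F = F ->
  (forall s, G s -> (P s - c) *m F = 0) ->
  (forall s, G s -> nrm s *m F = nrm s) ->
  (forall s l, 0 < l -> G s -> G (P s + l *: nrm s)) ->
  exists p : {poly R}, [/\ coef_nonneg p, (size p <= n + q.*2.+1)%N &
    forall l, 0 < l ->
      (\int[lebesgue_rV R n]_(s in G `&` [set s | (dot (nrm s) (nrm s) <= l ^+ 2)%R])
        (dot s s ^+ q)%:E = (p.[l])%:E)%E].
Proof.
move=> mG FT FF GF GN Gray.
pose phi l (s : 'rV[R]_n) := s *m scaling_mx F l + (c - c *m scaling_mx F l).
have phiE l s : G s -> phi l s = P s + l *: nrm s.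
  move=> Gs; rewrite /phi addrCA -mulmxBl mul_scaling_mx.
  have -> : (s - c) *m F = nrm s.
    by rewrite -[s in LHS](subrK (P s)) -addrA mulmxDl GN// GF// addr0.
  by rewrite addrA; congr (_ + _); rewrite /nrm opprB; apply/rowP => i; rewrite !mxE; ring.
have phiK l s : 0 < l -> phi l^-1 (phi l s) = s.
  move=> l0; rewrite /phi mulmxDl -mulmxA scaling_mxM// mulfV ?gt_eqF// scaling_mx1 mulmx1.
  rewrite mulmxBl -mulmxA scaling_mxM// mulfV ?gt_eqF// scaling_mx1 mulmx1.
  by apply/rowP => i; rewrite !mxE; ring.
have phiG l s : 0 < l -> G (phi l s) <-> G s.
  have h k t : 0 < k -> G t -> G (phi k t) by move=> k0 Gt; rewrite phiE//; exact: Gray.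
  move=> l0; split=> [Gl|]; last exact: h.
  by rewrite -(phiK l s l0); apply: h => //; rewrite invr_gt0.
pose A l := G `&` [set s | dot (nrm s) (nrm s) <= l ^+ 2].
have mA l : measurable (A l) by apply: measurableI => //; exact: measurable_dist_le.
have phiA l s : 0 < l -> A l (phi l s) <-> A 1 s.
  move=> l0.
  have E : G s -> (dot (nrm (phi l s)) (nrm (phi l s)) <= l ^+ 2) =
      (dot (nrm s) (nrm s) <= 1 ^+ 2).
    move=> Gs; rewrite phiE// (nrm_ray _ (ltW l0)).
    rewrite dotZl dotZr mulrA -expr2 ger_pMr ?exprn_gt0//.
    by rewrite expr1n.
  split=> -[/= Gs h]; have Gs' := Gs.
    by move/(phiG _ _ l0) : Gs' => Gs'; split => //=; rewrite -E.
  by move/(phiG _ _ l0) : Gs' => Gs'; split => //=; rewrite E.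
(* The squared norm of [P s + l *: nrm s] as a polynomial in [l]. Only the sign of its middle
   coefficient is in question, and the variational inequality at the point 0 settles it. *)
pose Q s : {poly R} := (dot (P s) (P s))%:P + (2 * dot (P s) (nrm s)) *: 'X
  + (dot (nrm s) (nrm s)) *: 'X^2.
have QE s l : (Q s).[l] = dot (P s + l *: nrm s) (P s + l *: nrm s).
  rewrite /Q; move: (nrm s) (P s) => u v.
  by rewrite !(hornerD, hornerZ, hornerC, hornerX, hornerXn) !dotE (dotC u v); ring.
have Q0 s : coef_nonneg (Q s).
  move=> k; rewrite !coefE; have [_ /(_ 0 K0)] := hP s; rewrite sub0r dotNl oppr_le0 => Pn.
  by rewrite !addr_ge0// ?mulr_ge0//; do ?case: ifP => _; rewrite ?dot_ge0 ?mulr_ge0 ?ler0n.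
have mQ : coef_measurable Q.
  move=> k; rewrite /Q; under eq_fun do rewrite !coefE.
  apply: measurable_funD; first apply: measurable_funD.
  - by case: eqP => _ //; exact: measurable_dot.
  - by apply: measurable_funM => //; apply: measurable_funM => //; exact: measurable_dot.
  - by apply: measurable_funM => //; exact: measurable_dot.
have sQ s : (size (Q s) <= 3)%N.
  rewrite (leq_trans (size_polyD _ _))// geq_max; apply/andP; split; last first.
    by rewrite (leq_trans (size_scale_leq _ _))// size_polyXn.
  rewrite (leq_trans (size_polyD _ _))// geq_max; apply/andP; split.
    by rewrite (leq_trans (size_polyC_leq1 _)).
  by rewrite (leq_trans (size_scale_leq _ _))// size_polyX.
have mdot : measurable_fun setT (fun s : 'rV[R]_n => (dot s s ^+ q)%:E).
  by apply/measurable_EFinP; apply: measurable_funX; exact: measurable_dot.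
have [p [p0 sp pE]] : exists p : {poly R}, [/\ coef_nonneg p, (size p <= q.*2.+1)%N &
    forall l, 0 <= l ->
      (\int[lebesgue_rV R n]_(s in A 1%R) ((Q s ^+ q).[l])%:E = (p.[l])%:E)%E].
  apply: integral_poly => //.
  - exact: coef_measurableX.
  - by move=> s; exact: coef_nonnegX.
  - move=> s; rewrite (leq_trans (size_poly_exp_leq _ _))// ltnS.
    by rewrite -mul2n leq_mul2r -subn1 leq_subLR sQ orbT.
  (* Points of [A 1] are within distance 1 of [K], so [A 1] is bounded; this yields the finiteness
     at [l = 1]. *)
  have A1 s : A 1 s -> rV_box (M + 1) s.
    move=> [_ /= s1] i; rewrite -[s 0 i](subrK (P s 0 i)) addrC.
    rewrite (le_trans (ler_normD _ _))// lerD//; first by apply: hM; case: (hP s).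
    rewrite -(@ler_pXn2r _ 2) ?nnegrE// real_normK ?num_real// (le_trans _ s1)//.
    by have := sqr_coord_le_dot (nrm s) i; rewrite !mxE.
  pose C := ((n%:R * (M + 1) ^+ 2) ^+ q)%:E.
  apply: (@le_lt_trans _ _ (\int[lebesgue_rV R n]_(s in rV_box (M + 1)) cst C s)%E).
    apply: (@le_trans _ _ (\int[lebesgue_rV R n]_(s in A 1%R) cst C s)%E).
      apply: ge0_le_integral => //.
      - by move=> s _; rewrite lee_fin horner_exp exprn_ge0// QE dot_ge0.
      - apply: measurable_funTS; under eq_fun do rewrite horner_exp QE scale1r addrC subrK.
        exact: mdot.
      - move=> s /A1 sM; rewrite lee_fin horner_exp QE scale1r [P s + _]addrC subrK.
        have C0 : 0 <= n%:R * (M + 1) ^+ 2 := mulr_ge0 (ler0n _ _) (sqr_ge0 _).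
        rewrite lerXn2r ?nnegrE ?dot_ge0//.
        have -> : n%:R * (M + 1) ^+ 2 = \sum_(i < n) (M + 1) ^+ 2.
          by rewrite sumr_const card_ord mulr_natl.
        apply: ler_sum => i _.
        rewrite -expr2 -real_normK ?num_real//.
        by rewrite ler_sqr ?nnegrE// (le_trans _ (sM i)).
    apply: ge0_subset_integral => //; first exact: rV_box_measurable.
    by move=> s _; rewrite /cst lee_fin exprn_ge0// mulr_ge0// sqr_ge0.
  rewrite integral_cst; last exact: rV_box_measurable.
  rewrite lte_mul_pinfty ?lebesgue_rV_box//.
  by rewrite lee_fin exprn_ge0// mulr_ge0// sqr_ge0.
have [r rn detE] := det_scaling_mx FF.
exists (p * 'X^r); split.
- apply: coef_nonnegM => // k; by rewrite coefXn ler0n.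
- rewrite (leq_trans (size_polyMleq _ _))// size_polyXn addnS/= addnC leq_add//.
move=> l l0; rewrite hornerM hornerXn.
pose f s := ((\1_(A l) s)%:E * (dot s s ^+ q)%:E)%E.
have mf : measurable_fun setT f.
  apply: emeasurable_funM => //; apply/measurable_EFinP; exact: measurable_indic.
have f0 s : (0 <= f s)%E.
  by rewrite /f -EFinM lee_fin mulr_ge0// exprn_ge0// dot_ge0.
rewrite -/(A l) [LHS]integral_mkcond.
transitivity (\int[lebesgue_rV R n]_s f s)%E.
  apply: eq_integral => s _; rewrite patchE /f indicE.
  by case: ifP => _; rewrite ?mul1e ?mul0e.
(* Pulling [f] back along [phi l] turns the indicator of [A l] into that of [A 1]; the determinant
   accounts for the factor ['X^r]. *)
rewrite -(integral_rV_affine (c - c *m scaling_mx F l) (definite_scaling_mx FT FF l0) mf f0).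
rewrite detE ger0_norm ?exprn_ge0 ?ltW// EFinM; congr (_ * _)%E.
rewrite -(pE _ (ltW l0)) [RHS]integral_mkcond; apply: eq_integral => s _.
rewrite patchE /f indicE -/(phi l s).
case: ifPn => [|/negP]; rewrite inE => sA.
  have -> : phi l s \in A l by rewrite inE phiA.
  by rewrite mul1e horner_exp QE phiE//; case: sA.
by have -> : phi l s \in A l = false; [apply/negP; rewrite inE phiA|rewrite mul0e].
Qed.
End region.

(** * Moments of parallel bodies of a polytope *)

Section polytope.
Variables (R : realType) (n q : nat).

Lemma moment_integralE (A : set 'rV[R]_n) : measurable A ->
  moment_integral A q = (\int[lebesgue_rV R n]_(s in A) (dot s s ^+ q)%:E)%E.
Proof.
move=> mA; rewrite /moment_integral lebesgue_int_RnE.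
- rewrite [RHS]integral_mkcond; apply: eq_integral => s _.
  rewrite patchE indicE exprM eucl_norm_sqr.
  by case: ifP => _; rewrite ?mul1r ?mul0r.
- apply/measurable_EFinP; under eq_fun do rewrite exprM eucl_norm_sqr.
  apply: measurable_funM; first exact: measurable_indic.
  by apply: measurable_funX; exact: measurable_dot.
- by move=> s; rewrite lee_fin mulr_ge0// exprn_ge0// sqrtr_ge0.
Qed.

Variables (I : finType) (a : I -> 'rV[R]_n) (b : I -> R).

Definition polytope : set 'rV[R]_n := [set x | forall i, dot (a i) x <= b i].

Variable P : 'rV[R]_n -> 'rV[R]_n.
Hypothesis hP : forall s, is_proj polytope s (P s).

(* The points whose projection lies in the relative interior of the face of
   the polytope on which exactly the constraints in [J] are active. *)
Definition active_region (J : {set I}) : set 'rV[R]_n :=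
  [set s | forall i, (dot (a i) (P s) == b i) = (i \in J)].

Lemma active_region_measurable J : measurable (active_region J).
Proof.
have -> : active_region J = \bigcap_(i in [set: I])
    [set s | (dot (a i) (P s) == b i) = (i \in J)].
  by apply/seteqP; split=> s h => [i _|i]; apply: h.
apply: fin_bigcap_measurable => [|i _]; first exact: finite_finset.
have m : measurable ((fun s => dot (a i) (P s)) @^-1` [set b i]).
  rewrite -[X in measurable X]setTI; apply: measurable_dot => //.
  exact: measurable_proj hP.
case: (i \in J).
  rewrite [X in measurable X](_ : _ = (fun s => dot (a i) (P s)) @^-1` [set b i])//.
  by apply/seteqP; split => s /=; case: eqP.
rewrite [X in measurable X](_ : _ = ~` ((fun s => dot (a i) (P s)) @^-1` [set b i])).
  exact: measurableC.
by apply/seteqP; split => s /=; case: eqP.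
Qed.

(** For small [t] both [P s + t v] and [P s - t v] stay in the polytope, since active constraints do
    not change and inactive ones have slack. The variational inequality in both directions forces
    equality. *)
Lemma active_region_normal J s v : active_region J s ->
  (forall i, i \in J -> dot (a i) v = 0) -> dot (s - P s) v = 0.
Proof.
move=> sJ vJ; have [Ks hs] := hP s.
pose slack i := b i - dot (a i) (P s).
have slack_gt0 i : i \notin J -> 0 < slack i.
  by move=> iJ; rewrite subr_gt0 lt_neqAle (sJ i) iJ; exact: Ks.
(* One [t] for all inactive constraints: the sum dominates each of its terms, and the added 1 keeps
   the denominator positive. *)
pose t := (1 + \sum_(i | i \notin J) `|dot (a i) v| / slack i)^-1.
have S0 : 0 <= \sum_(i | i \notin J) `|dot (a i) v| / slack i.
  by apply: sumr_ge0 => i iJ; rewrite divr_ge0// ltW// slack_gt0.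
have t0 : 0 < t by rewrite invr_gt0 ltr_wpDr.
have tslack i : i \notin J -> t * `|dot (a i) v| <= slack i.
  move=> iJ; rewrite mulrC ler_pdivrMr ?ltr_wpDr// mulrC -ler_pdivrMr ?slack_gt0//.
  rewrite (bigD1 i)//= addrCA lerDl addr_ge0//.
  by apply: sumr_ge0 => j /andP[jJ _]; rewrite divr_ge0// ltW// slack_gt0.
have inK u : `|u| = 1 -> polytope (P s + (u * t) *: v).
  move=> u1 i; rewrite dotDr dotZr; have [iJ|iJ] := boolP (i \in J).
    by rewrite vJ// mulr0 addr0; exact: Ks.
  rewrite addrC -lerBrDr (le_trans (ler_norm _))// !normrM u1 mul1r.
  by rewrite (gtr0_norm t0); exact: tslack.
have h u : `|u| = 1 -> u * dot (s - P s) v <= 0.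
  move=> u1; have := hs _ (inK u u1).
  by rewrite [P s + _]addrC addrK dotZl [u * t]mulrC -mulrA (pmulr_rle0 _ t0) (dotC v).
have := h 1 (normr1 _); have := h (-1); rewrite normrN normr1 => /(_ erefl).
by move=> h1 h2; apply/eqP; rewrite eq_le; apply/andP; split; lra.
Qed.

Hypothesis K0 : polytope 0.
Variable M : R.
Hypothesis hM : forall p, polytope p -> forall i, `|p 0 i| <= M.

Lemma integral_active_region J :
  exists p : {poly R}, [/\ coef_nonneg p, (size p <= n + q.*2.+1)%N &
    forall l, 0 < l ->
      (\int[lebesgue_rV R n]_(s in active_region J `&`
           [set s | (dot (s - P s) (s - P s) <= l ^+ 2)%R])
        (dot s s ^+ q)%:E = (p.[l])%:E)%E].
Proof.
(* Inactive constraints give zero rows, so the row space is the span of the active normals. *)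
pose A : 'M[R]_(#|I|, n) :=
  \matrix_(k, j) if enum_val k \in J then a (enum_val k) 0 j else 0.
have [F [FT FF FA FN]] := orthogonal_projector_ex A.
have AE (v : 'rV[R]_n) : v *m A^T = 0 <-> forall i, i \in J -> dot (a i) v = 0.
  split=> [/rowP vA i iJ|vJ].
    have := vA (enum_rank i); rewrite !mxE => <-; apply: eq_bigr => j _.
    by rewrite !mxE enum_rankK iJ mulrC.
  apply/rowP => k; rewrite !mxE; have [iJ|iJ] := boolP (enum_val k \in J).
    rewrite -[RHS](vJ _ iJ); apply: eq_bigr => j _.
    by rewrite !mxE iJ mulrC.
  by rewrite big1// => j _; rewrite !mxE (negbTE iJ) mulr0.
have GN s : active_region J s -> (s - P s) *m F = s - P s.
  (* Membership in the row space is tested on the columns of [cokermx A]; each is orthogonal to the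
     active normals, hence to [s - P s]. *)
  move=> sJ; apply: FA; rewrite submxE; apply/eqP/rowP => j.
  rewrite mxE [RHS]mxE; pose v := (col j (cokermx A))^T.
  rewrite -[RHS](@active_region_normal J s v)//; last first.
    apply/AE/rowP => k; have /matrixP/(_ k j) := mulmx_coker A.
    rewrite !mxE => E; rewrite -[RHS]E; apply: eq_bigr => i _.
    by rewrite !mxE mulrC.
  by apply: eq_bigr => k _; rewrite !mxE.
(* An empty region contributes 0. Otherwise the projection of any of its points serves as [c],
   because two such projections differ by a vector orthogonal to the active normals. *)
have [[s0 s0J]|noJ] := pselect (exists s, active_region J s); last first.
  exists 0; split; [by move=> k; rewrite coef0|by rewrite size_poly0|].
  move=> l _; rewrite (_ : active_region J = set0) ?set0I ?integral_set0 ?horner0//.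
  by apply/seteqP; split=> // s sJ; apply: noJ; exists s.
apply: (integral_region q hP K0 hM (F := F) (c := P s0)) => //.
- exact: active_region_measurable.
- move=> s sJ; apply: FN; apply/AE => i iJ; rewrite dotDr dotNr.
  by move: (sJ i) (s0J i); rewrite iJ => /eqP-> /eqP->; rewrite subrr.
- move=> s l l0 sJ i; rewrite -(sJ i); congr (dot _ _ == _).
  by apply: (is_proj_uniq (hP _)); apply: is_proj_ray => //; exact: ltW.
Qed.

(** Each point lies in exactly one region, that of the constraints active at its projection, so the
    moment is a finite sum over [J]. *)
Lemma polytope_moment :
  exists p : {poly R}, [/\ coef_nonneg p, (size p <= n + q.*2.+1)%N &
    forall l, 0 < l -> moment_integral (mink_ball polytope l) q = (p.[l])%:E].
Proof.
pose p J := projT1 (cid (integral_active_region J)).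
have hp J : [/\ coef_nonneg (p J), (size (p J) <= n + q.*2.+1)%N &
    forall l, 0 < l ->
      (\int[lebesgue_rV R n]_(s in active_region J `&`
           [set s | (dot (s - P s) (s - P s) <= l ^+ 2)%R])
        (dot s s ^+ q)%:E = ((p J).[l])%:E)%E] by rewrite /p; case: cid.
exists (\sum_J p J); split.
- move=> k; rewrite coef_sum; apply: sumr_ge0 => J _; by have [+ _ _] := hp J; apply.
- rewrite (leq_trans (size_sum _ _ _))//; apply/bigmax_leqP => J _.
  by have [_ + _] := hp J.
move=> l l0; rewrite horner_sum -sumEFin.
have mD J : measurable (active_region J `&`
    [set s | (dot (s - P s) (s - P s) <= l ^+ 2)%R]).
  apply: measurableI; first exact: active_region_measurable.
  exact: (measurable_dist_le hP).
have DE : mink_ball polytope l = \big[setU/set0]_(J : {set I}) (active_region J `&`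
    [set s | (dot (s - P s) (s - P s) <= l ^+ 2)%R]).
  rewrite -bigcup_seq; apply/seteqP; split=> [s /(mink_ballE (ltW l0) (hP s)) sl|].
    exists [set i | dot (a i) (P s) == b i]%SET; first by rewrite /= mem_index_enum.
    by split=> // i; rewrite inE.
  by move=> s [J _ [_ sl]]; apply/(mink_ballE (ltW l0) (hP s)).
rewrite DE moment_integralE; last by apply: bigsetU_measurable.
rewrite ge0_integral_bigsetU//.
- by apply: eq_bigr => J _; have [_ _ ->] := hp J.
- exact: index_enum_uniq.
- move=> J J' _ _ [s [[sJ _] [sJ' _]]]; apply/setP => i.
  by rewrite -(sJ i) -(sJ' i).
- apply: measurable_funTS; apply/measurable_EFinP; apply: measurable_funX.
  exact: measurable_dot.
- by move=> s _; rewrite lee_fin exprn_ge0// dot_ge0.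
Qed.
End polytope.

(** * Outer approximation by polytopes *)

Section polytope_approximation.
Variables (R : realType) (n : nat).
Implicit Types (K : set 'rV[R]_n) (P : 'rV[R]_n -> 'rV[R]_n).

Lemma rV_box_compact (M : R) : compact (@rV_box R n M).
Proof.
have -> : @rV_box R n M = [set s | forall i, `[-M, M]%classic (s 0 i)].
  by apply/seteqP; split=> s h i; have := h i; rewrite /= in_itv/= ler_norml.
by apply: (@rV_compact R n (fun=> `[-M, M]%classic)) => i; exact: segment_compact.
Qed.

Lemma compact_sub_rV_box K : compact K -> exists M, K `<=` rV_box M.
Proof.
move=> cK; have [->|/set0P K0] := eqVneq K set0; first by exists 0.
have cf : continuous (fun s : 'rV[R]_n => dot s s).
  by apply: continuous_dot => i; exact: coord_continuous.
have [p _ maxp] := EVT_max_rV K0 cK (continuous_subspaceT cf).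
(* A number whose square is at most [|p|^2] is at most [1 + |p|^2] in absolute value. *)
exists (1 + dot p p) => s Ks i; have : dot s s <= dot p p by apply: maxp; rewrite inE.
have := sqr_coord_le_dot s i; rewrite -real_normK ?num_real//; nra.
Qed.

(** The cross term is controlled by [b.c <= 1], read off from [|b - c|^2 >= 0]. *)
Lemma dot_add_unit_balls (b c : 'rV[R]_n) (k l : R) : 0 <= k -> 0 <= l ->
  eucl_norm b <= 1 -> eucl_norm c <= 1 ->
  dot (k *: b + l *: c) (k *: b + l *: c) <= (k + l) ^+ 2.
Proof.
have E u : eucl_norm u <= 1 -> dot u u <= 1.
  by rewrite -eucl_norm_sqr => h; rewrite expr_le1// sqrtr_ge0.
move=> k0 l0 /E b1 /E c1; have := dot_ge0 (b - c).
rewrite !dotE (dotC c b) => bc.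
have bc1 : dot b c <= 1 by lra.
have h1 : k * (k * dot b b) <= k * k by rewrite mulrA ler_piMr// mulr_ge0.
have h2 : l * (l * dot c c) <= l * l by rewrite mulrA ler_piMr// mulr_ge0.
have h3 : k * (l * dot b c) <= k * l by rewrite mulrA ler_piMr// mulr_ge0.
have -> : (k + l) ^+ 2 = k * k + 2 * (k * l) + l * l by ring.
lra.
Qed.

Lemma mink_ball_mink_ball K k l : 0 <= k -> 0 <= l ->
  mink_ball (mink_ball K k) l `<=` mink_ball K (k + l).
Proof.
move=> k0 l0 _ [_ [b [[x [c [Kx [c1 ->]]]] [b1 ->]]]].
have kl0 : 0 <= k + l by rewrite addr_ge0.
have h := dot_add_unit_balls k0 l0 c1 b1.
have [/eqP kl|kl] := eqVneq (k + l) 0.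
  move: kl; rewrite paddr_eq0// => /andP[/eqP-> /eqP->].
  exists x, c; split=> //; split=> //; rewrite addr0 !scale0r !addr0//.
exists x, ((k + l)^-1 *: (k *: c + l *: b)); split=> //; split.
  rewrite /unit_ball/= -(@ler_pXn2r _ 2) ?nnegrE ?sqrtr_ge0 ?ler01//.
  rewrite eucl_norm_sqr dotZl dotZr mulrA -expr2 expr1n exprVn mulrC.
  by rewrite ler_pdivrMr ?mul1r// exprn_gt0// lt0r kl.
by rewrite scalerA mulfV// scale1r addrA.
Qed.

Lemma mink_ballS K K' (l : R) : K `<=` K' -> mink_ball K l `<=` mink_ball K' l.
Proof. by move=> KK' _ [x [b [Kx [b1 ->]]]]; exists x, b; split; [exact: KK'|]. Qed.

Lemma mink_ball_le K (k l : R) : 0 <= k -> k <= l -> mink_ball K k `<=` mink_ball K l.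
Proof.
move=> k0 kl s [x [b [Kx [b1 ->]]]].
rewrite -(subrK k l) addrC; apply: mink_ball_mink_ball => //; first by rewrite subr_ge0.
exists (x + k *: b), 0; split; first by exists x, b.
split; last by rewrite scaler0 addr0.
by rewrite /unit_ball/= /eucl_norm big1 ?sqrtr0 ?ler01// => i _; rewrite mxE expr0n.
Qed.

Lemma polytope_convex (I : finType) (a : I -> 'rV[R]_n) b : convex (polytope a b).
Proof.
move=> x y t /andP[t0 t1] Kx Ky i; rewrite dotDr dotZr dotDr dotNr.
have -> : dot (a i) x + t * (dot (a i) y - dot (a i) x) =
  (1 - t) * dot (a i) x + t * dot (a i) y by ring.
have -> : b i = (1 - t) * b i + t * b i by ring.
by rewrite lerD// ler_wpM2l// ?subr_ge0.
Qed.

Lemma polytope_closed (I : finType) (a : I -> 'rV[R]_n) b : closed (polytope a b).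
Proof.
have -> : polytope a b = \bigcap_(i in [set: I]) [set x | dot (a i) x <= b i].
  by apply/seteqP; split=> s h => [i _|i]; apply: h.
apply: closed_bigI => i _.
have cf : continuous (fun x => dot (a i) x).
  by apply: continuous_dot => j; [exact: cst_continuous|exact: coord_continuous].
by have := (continuous_closedP _).1 cf _ (@closed_le R (b i)).
Qed.

Lemma measurable_mink_ball K P (l : R) : (forall s, is_proj K s (P s)) -> 0 <= l ->
  measurable (mink_ball K l).
Proof.
move=> hP l0; have -> : mink_ball K l = [set s | dot (s - P s) (s - P s) <= l ^+ 2].
  by apply/seteqP; split=> s /(mink_ballE l0 (hP s)).
exact: (measurable_dist_le hP).
Qed.

(* By convexity a polytope containing [K] that avoids the shell of points at
   distance [e] from [K] stays within distance [e] of [K]. *)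
Lemma polytope_approx K P (e : R) : compact K -> (forall s, is_proj K s (P s)) ->
  0 < e -> exists (I : finType) (a : I -> 'rV[R]_n) (b : I -> R),
    K `<=` polytope a b /\ polytope a b `<=` mink_ball K e.
Proof.
move=> cK hP e0; pose f (s : 'rV[R]_n) := s - P s.
pose S := [set s | dot (f s) (f s) = e ^+ 2].
have cf i : continuous (fun s => f s 0 i).
  rewrite (_ : (fun s => _) = (fun s : 'rV[R]_n => s 0 i - P s 0 i)); last first.
    by apply/funext => y; rewrite !mxE.
  move=> y; apply: (@continuousB R R^o _ (fun s : 'rV[R]_n => s 0 i) (fun s => P s 0 i)).
    exact: coord_continuous.
  exact: continuous_proj hP i y.
have clS : closed S.
  by have := (continuous_closedP _).1 (continuous_dot cf cf) _ (@closed_eq R (e ^+ 2)).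
have cS : compact S.
  have [M KM] := compact_sub_rV_box cK.
  apply: (subclosed_compact clS (@rV_box_compact (M + e))) => s Ss i.
  rewrite -[s 0 i](subrK (P s 0 i)) addrC (le_trans (ler_normD _ _))// lerD//.
    by apply: KM; have [] := hP s.
  rewrite -ler_sqr ?nnegrE ?(ltW e0)// real_normK ?num_real// -Ss.
  by have := sqr_coord_le_dot (f s) i; rewrite !mxE.
(* The open half-space beyond the hyperplane supporting [K] at [P x]. Finitely many cover the
   compact shell [S]; their complements define the polytope. *)
pose U x := [set y | 0 < dot (f x) (y - P x)].
have oU x : S x -> open (U x).
  move=> _; have cg : continuous (fun y : 'rV[R]_n => dot (f x) (y - P x)).
    apply: continuous_dot => i; first exact: cst_continuous.
    rewrite (_ : (fun s => _) = (fun s : 'rV[R]_n => s 0 i - P x 0 i)); last first.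
      by apply/funext => y; rewrite !mxE.
    move=> y; apply: (@continuousB R R^o _ (fun s : 'rV[R]_n => s 0 i) (cst (P x 0 i))).
      exact: coord_continuous.
    exact: cst_continuous.
  by have := (continuousP _).1 cg _ (@open_gt R 0).
move: cS; rewrite compact_cover => /(_ _ S U oU)[x Sx|D _ SD].
  by exists x => //; rewrite /U/= Sx exprn_gt0.
exists (seq_sub (finmap.enum_fset D)), (fun x => f (ssval x)),
  (fun x => dot (f (ssval x)) (P (ssval x))); split=> [y Ky x|y Py].
  have [_ /(_ _ Ky)] := hP (ssval x).
  by rewrite dotC -/(f _) dotDr dotNr subr_le0.
apply/(mink_ballE (ltW e0) (hP y)); rewrite -/(f y) leNgt; apply/negP => ye.
have y0 : 0 < dot (f y) (f y) by rewrite (lt_trans _ ye)// exprn_gt0.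
(* [P y + t (y - P y)] is the point of the segment from [P y] to [y] at distance exactly [e] from
   [K]: convexity puts it in the polytope, the cover of the shell puts it outside. *)
pose t := e / Num.sqrt (dot (f y) (f y)).
have s0 : 0 < Num.sqrt (dot (f y) (f y)) by rewrite sqrtr_gt0.
have t0 : 0 <= t by rewrite divr_ge0// ltW.
have t1 : t <= 1.
  rewrite ler_pdivrMr// mul1r -ler_sqr ?nnegrE ?(ltW e0) ?(ltW s0)//.
  by rewrite sqr_sqrtr (ltW ye, ltW y0).
have Pz : P (P y + t *: f y) = P y.
  by apply: (is_proj_uniq (hP _)); exact: is_proj_ray.
have [|x xD Ux] := SD (P y + t *: f y).
  rewrite /S/= /f Pz [P y + _]addrC addrK -/(f y) dotZl dotZr mulrA -expr2.
  by rewrite /t expr_div_n sqr_sqrtr ?ltW// divfK ?gt_eqF.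
have PPy : polytope (fun x : seq_sub (finmap.enum_fset D) => f (ssval x))
    (fun x => dot (f (ssval x)) (P (ssval x))) (P y).
  move=> x'; have [_ /(_ (P y))] := hP (ssval x').
  by rewrite dotC -/(f _) dotDr dotNr subr_le0; apply; have [] := hP y.
have t01 : 0 <= t <= 1 by rewrite t0 t1.
have := polytope_convex t01 PPy Py (SeqSub xD).
rewrite /= -/(f y) leNgt => /negP; apply.
have : 0 < dot (f x) (P y + t *: f y) - dot (f x) (P x) by rewrite -dotNr -dotDr.
by rewrite subr_gt0.
Qed.
End polytope_approximation.

(** * Limits of polynomials and right continuity of the moment *)

Section limits.
Variable R : realType.

Lemma cvg_sumr (I : Type) (r : seq I) (f : I -> nat -> R) (l : I -> R) :
  (forall i, f i @ \oo --> l i) ->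
  (fun k => \sum_(i <- r) f i k) @ \oo --> \sum_(i <- r) l i.
Proof.
move=> fl; elim: r => [|i r IH].
  by under eq_fun do rewrite big_nil; rewrite big_nil; exact: cvg_cst.
under eq_fun do rewrite big_cons; rewrite big_cons.
exact: cvgD.
Qed.

(* The coefficients are recovered from the values at [1, ..., N] by inverting a
   Vandermonde matrix, hence they converge. *)
Lemma limit_of_nonneg_polys N (p : nat -> {poly R}) (g : R -> R) :
  (forall k, coef_nonneg (p k)) -> (forall k, (size (p k) <= N)%N) ->
  (forall l, 0 < l -> (fun k => (p k).[l]) @ \oo --> g l) ->
  exists2 p' : {poly R}, coef_nonneg p' & forall l, 0 < l -> g l = p'.[l].
Proof.
(* The nodes are distinct, so that the Vandermonde matrix is invertible, and positive, because
   convergence is assumed for [l > 0] only. *)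
move=> p0 sp pg; pose x : 'rV[R]_N := \row_j j.+1%:R.
pose V := Vandermonde N x.
have uV : V \in unitmx.
  rewrite unitmxE unitfE det_Vandermonde; apply/prodf_neq0 => i _.
  by apply/prodf_neq0 => j ij; rewrite !mxE subr_eq0 eqr_nat eqSS gtn_eqF.
pose c k : 'rV[R]_N := \row_i (p k)`_i.
pose vals (h : R -> R) : 'rV[R]_N := \row_j h (x 0 j).
have cE k : c k = vals (horner (p k)) *m invmx V.
  rewrite -[LHS](mulmxK uV); congr (_ *m _); apply/rowP => j; rewrite !mxE.
  rewrite (horner_coef_wide _ (sp k)); apply: eq_bigr => i _.
  by rewrite !mxE.
have cg (i : 'I_N) : (fun k => (p k)`_i) @ \oo --> (vals g *m invmx V) 0 i.
  have -> : (fun k => (p k)`_i) = (fun k => \sum_j (p k).[x 0 j] * invmx V j i).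
    apply/funext => k; have /rowP/(_ i) := cE k; rewrite !mxE => ->.
    by apply: eq_bigr => j _; rewrite !mxE.
  rewrite [X in _ --> X]mxE; apply: cvg_sumr => j; rewrite [vals g 0 j]mxE.
  have x0 : 0 < x 0 j by rewrite mxE ltr0n.
  exact: (cvgM (pg _ x0) (cvg_cst _)).
pose c' : 'rV[R]_N := vals g *m invmx V.
exists (\poly_(i < N) (if insub i is Some j then c' 0 j else 0)) => [i|l l0].
  rewrite coef_poly; case: ifP => // iN; case: insubP => // j _ _.
  apply: (cvgr_to_ge (cg j)); by apply: nearW => k; exact: p0.
apply: (norm_cvg_unique (pg l l0)); rewrite /= horner_poly.
under eq_fun do rewrite (horner_coef_wide _ (sp _)).
apply: cvg_sumr => i; rewrite valK.
exact: (cvgM (cg i) (cvg_cst _)).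
Qed.

(** A point outside [K + l B] is at distance strictly greater than [l] from [K], so the indicators
    are eventually constant at each point; the integrand on [K + (l + 1) B] dominates. *)
Lemma moment_cvg_right n q (K : set 'rV[R]_n) (P : 'rV[R]_n -> 'rV[R]_n) (l : R) :
  (forall s, is_proj K s (P s)) -> 0 <= l ->
  (moment_integral (mink_ball K (l + 1)) q < +oo)%E ->
  (fun k => moment_integral (mink_ball K (l + harmonic k)) q) @ \oo -->
  moment_integral (mink_ball K l) q.
Proof.
move=> hP l0; pose g (s : 'rV[R]_n) := (dot s s ^+ q)%:E.
have g0 s : (0 <= g s)%E by rewrite lee_fin exprn_ge0// dot_ge0.
have mg : measurable_fun setT g.
  by apply/measurable_EFinP; apply: measurable_funX; exact: measurable_dot.
have mB k : 0 <= k -> measurable (mink_ball K k) by exact: measurable_mink_ball hP.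
have h0 k : 0 <= @harmonic R k by rewrite harmonic_ge0.
have h1 k : @harmonic R k <= 1 by rewrite /harmonic invf_le1 ?ler1n ?ltr0n.
have mf k : 0 <= k -> measurable_fun setT (g \_ (mink_ball K k)).
  move=> k0; apply/(measurable_restrictT _ _).1; first exact: mB.
  exact: measurable_funTS.
have lh0 k : 0 <= l + @harmonic R k by rewrite addr_ge0.
have l10 : 0 <= l + 1 by rewrite addr_ge0.
have E k : 0 <= k -> moment_integral (mink_ball K k) q =
    (\int[lebesgue_rV R n]_s (g \_ (mink_ball K k)) s)%E.
  by move=> k0; rewrite (moment_integralE q (mB k k0)) [LHS]integral_mkcond.
rewrite !E// => Ey.
have r0 k s : (0 <= (g \_ (mink_ball K k)) s)%E by rewrite patchE; case: ifP.
have ig : (lebesgue_rV R n).-integrable setT (g \_ (mink_ball K (l + 1))).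
  apply/integrableP; split; first exact: mf.
  by under eq_integral do rewrite gee0_abs//.
under eq_fun do rewrite E//.
have [] := @dominated_convergence _ _ _ (lebesgue_rV R n) _ measurableT
  (fun k => g \_ (mink_ball K (l + harmonic k))) (g \_ (mink_ball K l))
  (g \_ (mink_ball K (l + 1))) (fun k => mf _ (lh0 k)) (mf _ l0) _ ig _ => //.
- apply: aeW => s _; have [sl|sl] := pselect (mink_ball K l s).
    apply: cvg_near_cst; apply: nearW => k; rewrite !patchE !mem_set//.
    by apply: (mink_ball_le l0 _ sl); rewrite lerDl.
  have sl' : l ^+ 2 < dot (s - P s) (s - P s).
    by rewrite ltNge; apply/negP => h; apply: sl; apply/(mink_ballE l0 (hP s)).
  have : (fun k => (l + @harmonic R k) ^+ 2) @ \oo --> (l + 0) ^+ 2.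
    have c : (fun k => l + @harmonic R k) @ \oo --> l + 0.
      by apply: cvgD; [exact: cvg_cst|exact: cvg_harmonic].
    by rewrite !expr2; apply: cvgM.
  rewrite addr0 => /cvgr_lt/(_ _ sl'); move=> near_lt; apply: cvg_near_cst.
  apply: filterS near_lt => k hk; rewrite !patchE !memNset// => /(mink_ballE (lh0 k) (hP s)).
  by rewrite leNgt hk.
- apply: aeW => s k _; rewrite gee0_abs//.
  rewrite !patchE; case: ifPn => [|_]; last by case: ifP.
  rewrite inE => sk; rewrite mem_set//; apply: (mink_ball_le (lh0 k) _ sk).
  by rewrite lerD2l.
Qed.
End limits.

(** * Passage from polytopes to general convex sets *)

Lemma moment_integral_le (R : realType) n q (A B : set 'rV[R]_n) :
  measurable A -> measurable B -> A `<=` B ->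
  (moment_integral A q <= moment_integral B q)%E.
Proof.
move=> mA mB AB; rewrite !moment_integralE//; apply: ge0_subset_integral => //.
- apply: measurable_funTS; apply/measurable_EFinP; apply: measurable_funX.
  exact: measurable_dot.
- by move=> s _; rewrite lee_fin exprn_ge0// dot_ge0.
Qed.

Lemma moment_integral_ge0 (R : realType) n q (A : set 'rV[R]_n) :
  measurable A -> (0 <= moment_integral A q)%E.
Proof.
move=> mA; rewrite moment_integralE//; apply: integral_ge0 => s _.
by rewrite lee_fin exprn_ge0// dot_ge0.
Qed.

(** [p] comes from a polytope lying between [K] and [K + e B]. The size bound does not depend on
    [e], as the limit requires. *)
Lemma moment_sandwich (R : realType) n q (K : set 'rV[R]_n)
    (P : 'rV[R]_n -> 'rV[R]_n) (e : R) :
  compact K -> (forall s, is_proj K s (P s)) -> K 0 -> 0 < e ->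
  exists p : {poly R}, [/\ coef_nonneg p, (size p <= n + q.*2.+1)%N &
    forall l, 0 < l -> (moment_integral (mink_ball K l) q <= (p.[l])%:E
      <= moment_integral (mink_ball K (l + e)) q)%E].
Proof.
move=> cK hP K0 e0; have [I [a [b [Kab abK]]]] := polytope_approx cK hP e0.
have [M KM] := compact_sub_rV_box cK.
have abM : polytope a b `<=` rV_box (M + e).
  move=> _ /abK[x [c [Kx [c1 ->]]]] i; rewrite !mxE (le_trans (ler_normD _ _))// lerD//.
    exact: KM.
  rewrite normrM gtr0_norm// ler_piMr ?(ltW e0)//.
  rewrite -(@ler_pXn2r _ 2) ?nnegrE ?ler01// real_normK ?num_real//.
  rewrite (le_trans (sqr_coord_le_dot c i))// -eucl_norm_sqr.
  by rewrite ler_pXn2r ?nnegrE ?sqrtr_ge0 ?ler01.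
have cab : compact (polytope a b).
  exact: subclosed_compact (@polytope_closed _ _ _ a b) (@rV_box_compact _ _ _) abM.
have ab0 : polytope a b 0 by exact: Kab.
have prj s := is_proj_ex s (ex_intro _ 0 ab0) cab (@polytope_convex _ _ _ a b).
pose P' s := projT1 (cid (prj s)).
have hP' s : is_proj (polytope a b) s (P' s) by rewrite /P'; case: cid.
have [p [p0 sp pE]] := polytope_moment q hP' ab0 abM.
exists p; split=> // l l0; rewrite -pE//.
have le0 : 0 <= l + e by rewrite addr_ge0// ltW.
have l0' := ltW l0.
apply/andP; split; apply: moment_integral_le.
- exact: (measurable_mink_ball hP l0').
- exact: (measurable_mink_ball hP' l0').
- exact: mink_ballS.
- exact: (measurable_mink_ball hP' l0').
- exact: (measurable_mink_ball hP le0).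
- rewrite addrC; apply: subset_trans (mink_ball_mink_ball (ltW e0) l0').
  exact: mink_ballS.
Qed.

Theorem theorem6p1 (R : realType) (d q : nat) (K : set 'rV[R]_d) :
  K !=set0 -> compact K ->
  convex_set (K : set (convex_lmodType 'rV[R]_d)) ->
  K 0 ->
  exists p : {poly R},
    (forall i : nat, 0 <= p`_i) /\
    (forall eps : R, 0 <= eps -> moment_integral (mink_ball K eps) q = (p.[eps])%:E).
Proof.
move=> Kne cK /convex_setE vK K0.
pose P s := projT1 (cid (is_proj_ex s Kne cK vK)).
have hP s : is_proj K s (P s) by rewrite /P; case: cid.
have hpos k : 0 < @harmonic R k by rewrite /harmonic invr_gt0 ltr0n.
pose p k := projT1 (cid (moment_sandwich q cK hP K0 (hpos k))).
have hp k : [/\ coef_nonneg (p k), (size (p k) <= d + q.*2.+1)%N &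
    forall l, 0 < l -> (moment_integral (mink_ball K l) q <= ((p k).[l])%:E
      <= moment_integral (mink_ball K (l + harmonic k)) q)%E].
  by rewrite /p; case: cid.
pose F l := moment_integral (mink_ball K l) q.
have F_ge0 l : 0 <= l -> (0 <= F l)%E.
  by move=> l0; apply: moment_integral_ge0; exact: measurable_mink_ball hP l0.
have F_le k l : 0 <= k -> k <= l -> (F k <= F l)%E.
  move=> k0 kl; apply: moment_integral_le; last exact: mink_ball_le.
    exact: (measurable_mink_ball hP).
  by apply: (measurable_mink_ball hP); rewrite (le_trans k0).
have F_fin l : 0 <= l -> F l \is a fin_num.
  move=> l0; rewrite ge0_fin_numE ?F_ge0//.
  (* The sandwich holds at positive radii, hence the shift to [l + 1]; monotonicity brings the bound
     back to [l], including [l = 0]. *)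
  have [_ _ /(_ (l + 1))] := hp 0%N; rewrite ltr_wpDl// => /(_ isT)/andP[h _].
  apply: (le_lt_trans (F_le l (l + 1) l0 _)); first by rewrite lerDl.
  exact: (le_lt_trans h (ltry _)).
have F_cvg l : 0 <= l -> (fun k => fine (F (l + harmonic k))) @ \oo --> fine (F l).
  move=> l0; have l10 : 0 <= l + 1 by rewrite addr_ge0.
  apply: fine_cvg; rewrite fineK ?F_fin//; apply: (moment_cvg_right hP l0).
  by rewrite -/(F _) -ge0_fin_numE ?F_ge0// F_fin.
have lh0 l k : 0 <= l -> 0 <= l + @harmonic R k.
  by move=> l0; rewrite addr_ge0// ltW.
have pF l : 0 < l -> (fun k => (p k).[l]) @ \oo --> fine (F l).
  move=> l0; have l0' := ltW l0.
  apply: (@squeeze_cvgr _ _ _ _ (cst (fine (F l))) (fun k => fine (F (l + harmonic k)))).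
  - apply: nearW => k; have [_ _ /(_ _ l0)] := hp k; rewrite -!/(F _).
    by rewrite -{1}(fineK (F_fin _ l0')) -{1}(fineK (F_fin _ (lh0 l k l0'))) !lee_fin.
  - exact: cvg_cst.
  - exact: F_cvg.
have [p' p'0 FE] := limit_of_nonneg_polys (fun k => let: And3 h _ _ := hp k in h)
  (fun k => let: And3 _ h _ := hp k in h) pF.
(* At radius 0 both sides are limits along [1/(k+1)]: the moment by right continuity, the polynomial
   by continuity. *)
exists p'; split=> // l; rewrite le_eqVlt => /orP[/eqP <-|l0]; last first.
  by rewrite -FE// fineK// F_fin ?ltW.
rewrite -[LHS](fineK (F_fin 0 (lexx 0))); congr EFin.
apply: (norm_cvg_unique (F_cvg 0 (lexx 0))) => /=.
under eq_fun do rewrite add0r FE//.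
apply: continuous_cvg; first exact: continuous_horner.
exact: cvg_harmonic.
Qed.
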